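(* Let $n\ge m+1$, let $v=(n-m,\dots,n,\ n-m-1,\dots,1)\in S_n$, and let $w\in S_n$ and the CI statement $A\perp\!\!\!\perp B\mid C$ be as in one of the following two cases: \begin{enumerate} \item $w=(n-l,\dots,n-l-k+1,\ n,\dots,n-l+1,\ n-l-k,\dots,1)$, where $l+k\le m$ and $A=[1,k]$, $B=[m-l+1,m]$, $C=\emptyset$; \item $w=(n,\ n-1-t,\dots,n-t-s,\ n-1,\dots,n-t,\ n-t-s-1,\dots,1)$, where $l+k=m+1$ for $k:=1+s$ and $l:=1+t$, and $A=[1,k-1]$, $B=[k+1,m]$, $C=\{k\}$. \end{enumerate} Then the complexity of $\mathcal N_{v,w}$ is $m\left(\frac{m-1}{2}\right)-|A||B|$.
   Context: Permutations are in one-line notation; the first block $n-m,\dots,n$ of $v$ is increasing by steps of $1$ (and its second block is decreasing), while all blocks of $w$ are decreasing runs of consecutive integers. Let $\le$ be the Bruhat order on $S_n$, $\ell$ the Coxeter length, $t_{a,b}$ the transposition of $a$ and $b$. Let $B$ (resp. $B_-$) denote here the upper (resp. lower) triangular Borel subgroup of $GL_n(\mathbb C)$ and $T$ the diagonal torus. The Kazhdan-Lusztig variety is $\mathcal N_{v,w}=\overline{BwB/B}\cap B_-vB/B\subset GL_n(\mathbb C)/B$, of dimension $\ell(w)-\ell(v)$. The usual torus action is that of $T$ by left multiplication. With $D^\circ(v)=\{(i,j): v(j)<i,\ v^{-1}(i)>j\}$, its weight cone is $\sigma_{v,w}=\mathrm{Cone}(e_{v(j)}-e_i : (i,j)\in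 D^\circ(v),\ t_{v(j),i}\,v\le w)\subset\mathbb R^n$, and the complexity of $\mathcal N_{v,w}$ is $\dim\mathcal N_{v,w}-\dim\sigma_{v,w}$. (The sets $A,B,C\subseteq[m]$ in the claim are index sets of a conditional independence statement for an $m$-dimensional Gaussian vector.) *)

(* Defs.v *)
From HB Require Import structures.
From mathcomp Require Import all_boot all_order all_fingroup all_algebra.
From mathcomp Require Import complex mpoly.
From mathcomp Require Import boolp classical_sets reals ereal.

Set Implicit Arguments.
Unset Strict Implicit.
Unset Printing Implicit Defensive.

Import Order.TTheory GRing.Theory Num.Theory.

Local Open Scope ring_scope.

(* 'S_n permutes {0, .., n-1}; one-line notation is written with the
   values 1, .., n. *)
Definition one_line (n : nat) (s : 'S_n) : seq nat :=
  [seq (s i).+1 | i <- enum 'I_n].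

(* [:: a; a + 1; ..; b], empty if b < a *)
Definition increasing_run (a b : nat) : seq nat := iota a (b.+1 - a).

(* [:: b; b - 1; ..; a], empty if b < a *)
Definition decreasing_run (b a : nat) : seq nat := rev (increasing_run a b).

(* On S_n the Coxeter length is the number of inversions. *)
Definition coxeter_length (n : nat) (s : 'S_n) : nat :=
  #|[set p : 'I_n * 'I_n | (p.1 < p.2)%N && (s p.2 < s p.1)%N]|.

(* x and y are related when y is x times a transposition and is longer; the
   product in 'S_n composes from left to right, so x * t maps i to t (x i). *)
Definition bruhat_step (n : nat) : rel 'S_n := fun x y =>
  [exists a : 'I_n, exists b : 'I_n, y == (x * tperm a b)%g]
  && (coxeter_length x < coxeter_length y)%N.

Definition bruhat_le (n : nat) (x y : 'S_n) : bool :=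
  connect (@bruhat_step n) x y.

Local Open Scope classical_set_scope.

Section Dimension.
Variables (R : realType) (X : Type) (closed_set : set (set X)).

Definition closed_in (Y Z : set X) : Prop :=
  exists2 F, closed_set F & Z = Y `&` F.

Definition irreducible (Z : set X) : Prop :=
  Z !=set0 /\
  forall F1 F2 : set X, closed_set F1 -> closed_set F2 ->
    Z `<=` F1 `|` F2 -> Z `<=` F1 \/ Z `<=` F2.

Definition closed_chain (Y : set X) (k : nat) (Z : nat -> set X) : Prop :=
  (forall i, (i <= k)%N -> closed_in Y (Z i) /\ irreducible (Z i)) /\
  (forall i, (i < k)%N -> Z i `<` Z i.+1).

(* the supremum of the lengths of chains of irreducible closed subsets of Y;
   it is -oo for the empty set *)
Definition krull_dim (Y : set X) : \bar R :=
  ereal_sup [set k%:R%:E | k in [set k | exists Z, closed_chain Y k Z]].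

End Dimension.

Section FlagVariety.
Variables (R : realType) (n : nat).

Local Notation C := (complex R).

Definition GL : set 'M[C]_n := [set g | g \in unitmx].

(* is_trig_mx is the predicate of lower triangular matrices *)
Definition lower_borel : set 'M[C]_n := [set b | GL b /\ is_trig_mx b].
Definition upper_borel : set 'M[C]_n := [set b | GL b /\ is_trig_mx b^T].

Definition coset_B (g : 'M[C]_n) : set 'M[C]_n :=
  [set g *m b | b in upper_borel].

Definition flag_variety : set (set 'M[C]_n) := [set coset_B g | g in GL].

Definition eval_poly_mx (p : {mpoly C[n * n]}) (g : 'M[C]_n) : C :=
  p.@[fun k => mxvec g 0 k].

(* 1 / det is a unit on GL_n, so polynomials in the entries suffice *)
Definition zariski_closed_GL (Z : set 'M[C]_n) : Prop :=
  exists I : set {mpoly C[n * n]},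
    Z = [set g | GL g /\ forall p, I p -> eval_poly_mx p g = 0].

(* the quotient of the Zariski topology of GL_n *)
Definition flag_closed (F : set (set 'M[C]_n)) : Prop :=
  F `<=` flag_variety /\ zariski_closed_GL [set g | GL g /\ F (coset_B g)].

Definition flag_closure (Y : set (set 'M[C]_n)) : set (set 'M[C]_n) :=
  \bigcap_(F in [set F | flag_closed F /\ Y `<=` F]) F.

(* The matrix of w has its 1's at the positions (w j, j), whereas those of
   perm_mx w are at (j, w j). *)
Definition permutation_matrix (w : 'S_n) : 'M[C]_n := (perm_mx w)^T.

(* B w B / B *)
Definition schubert_cell (w : 'S_n) : set (set 'M[C]_n) :=
  [set coset_B (b *m permutation_matrix w) | b in upper_borel].

(* B_- v B / B *)
Definition opposite_cell (v : 'S_n) : set (set 'M[C]_n) :=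
  [set coset_B (b *m permutation_matrix v) | b in lower_borel].

Definition kazhdan_lusztig (v w : 'S_n) : set (set 'M[C]_n) :=
  flag_closure (schubert_cell w) `&` opposite_cell v.

Definition opposite_diagram (v : 'S_n) : pred ('I_n * 'I_n) :=
  fun p => (v p.2 < p.1)%N && (p.2 < (v^-1)%g p.1)%N.

Definition weight_index (v w : 'S_n) : pred ('I_n * 'I_n) :=
  fun p => opposite_diagram v p && bruhat_le (v * tperm (v p.2) p.1)%g w.

Definition weight (v : 'S_n) (p : 'I_n * 'I_n) : 'rV[R]_n :=
  delta_mx 0 (v p.2) - delta_mx 0 p.1.

Definition weight_cone (v w : 'S_n) : set 'rV[R]_n :=
  [set x | exists2 c : 'I_n * 'I_n -> R, (forall p, 0 <= c p) &
     x = \sum_(p | weight_index v w p) c p *: weight v p].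

(* the smallest subspace containing K *)
Definition linear_span (K : set 'rV[R]_n) : {vspace 'rV[R]_n} :=
  xget 0%VS [set U : {vspace 'rV[R]_n} | (forall x, K x -> x \in U) /\
    forall W : {vspace 'rV[R]_n}, (forall x, K x -> x \in W) -> (U <= W)%VS].

Definition cone_dim (K : set 'rV[R]_n) : nat := \dim (linear_span K).

Definition complexity (v w : 'S_n) : \bar R :=
  (krull_dim R flag_closed (kazhdan_lusztig v w)
   - (cone_dim (weight_cone v w))%:R%:E)%E.

End FlagVariety.

Local Close Scope classical_set_scope.

(* The subset [a, b] of [m] = {1, .., m}; the element i : 'I_m stands for
   i + 1. *)
Definition segment (m a b : nat) : {set 'I_m} :=
  finset (fun i : 'I_m => (a <= i.+1 <= b)%N).

Definition base_permutation (n m : nat) (v : 'S_n) : Prop :=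
  one_line v = increasing_run (n - m) n ++ decreasing_run (n - m - 1) 1.

Definition marginal_CI_case (n m : nat) (w : 'S_n) (A B C : {set 'I_m}) : Prop :=
  exists k l : nat,
    [/\ (l + k <= m)%N,
        one_line w = decreasing_run (n - l) (n - l - k + 1)
                     ++ decreasing_run n (n - l + 1)
                     ++ decreasing_run (n - l - k) 1,
        A = segment m 1 k,
        B = segment m (m - l + 1) m
      & C = finset.set0].

Definition conditional_CI_case (n m : nat) (w : 'S_n) (A B C : {set 'I_m}) : Prop :=
  exists s t : nat,
    let k := (1 + s)%N in
    let l := (1 + t)%N in
    [/\ (l + k = m + 1)%N,
        one_line w = [:: n]
                     ++ decreasing_run (n - 1 - t) (n - t - s)
                     ++ decreasing_run (n - 1) (n - t)
                     ++ decreasing_run (n - t - s - 1) 1,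
        A = segment m 1 (k - 1),
        B = segment m (k + 1) m
      & C = segment m k k].

(* Main.v *)
Require Import Defs.
From mathcomp Require Import all_boot all_order all_fingroup all_algebra.
From mathcomp Require Import complex mpoly.
From mathcomp Require Import boolp classical_sets reals ereal.
From mathcomp Require Import zify ring.

(* The opposite cell of v is an affine space, with coordinates the entries below
   the diagonal of a unitriangular matrix of size m + 1 (the normal form
   [slice]).  Since w is the largest permutation whose south-west l x k corner
   has at most r nonzero entries (r = 0 in the marginal case, r = 1 in the
   conditional case), degenerating along transpositions and the Bruhat
   decomposition show that the Schubert variety of w is cut out by the condition
   that this corner has rank at most r.  So the Kazhdan-Lusztig variety is an
   affine space times the l x k matrices of rank at most r, of dimension
   m (m + 1) / 2 - (l - r) (k - r).  A chain of that length comes from making the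
   entries of the corner and of the other coordinates vanish row prefix by row
   prefix.  For the upper bound, a chain of q irreducible closed sets produces,
   for all N, about N ^ (dim B + q) linearly independent functions of degree O(N)
   on the preimage in GL_n of its largest member, while the charts of the variety
   only carry O(N ^ (dim B + d)) of them.  Finally the weight cone spans the
   m-dimensional space generated by the e_i - e_{i+1} for n - m <= i < n, because
   s_i v <= w for all these i. *)

Set Implicit Arguments.
Unset Strict Implicit.
Unset Printing Implicit Defensive.

Import Order.TTheory GRing.Theory Num.Theory.

(** * Bruhat order below the permutations w *)

(** All geometry of the flag variety is read off in GL_n: closed sets become zero sets invariant
    under right multiplication by B, and irreducibility becomes primality of the ideal vanishing on
    the preimage. If f vanishes on one member of a chain but not on the next, primality allows
    functions independent on the former to be multiplied by powers of f without creating relations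
    on the latter, so each step gains a factor N; the exponent dim B is the contribution of a single
    coset. Counting coefficients only requires finitely many charts that together reach every point;
    they need be neither injective nor open. Both families are treated at once through r in {0, 1}.
    For r = 1 the matrices of rank at most one do not form an affine space. The chain therefore
    fills only the last column of the block coordinate by coordinate; the other k - 1 columns are
    then opened one at a time through the irreducible sets of products s_i t_j, for k - 1 further
    steps. *)

Lemma coxeter_lengthV (n : nat) (x : 'S_n) : coxeter_length x^-1 = coxeter_length x.
Proof.
have le (y : 'S_n) : coxeter_length y <= coxeter_length y^-1.
  rewrite /coxeter_length -(card_imset _ (_ : injective (fun p : 'I_n * 'I_n => (y p.2, y p.1)))).
    apply/subset_leq_card/fintype.subsetP => _ /imsetP[p + ->].
    by rewrite !inE /= !permK andbC.
  by move=> [a b] [c d] [/perm_inj -> /perm_inj ->].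
by apply/eqP; rewrite eqn_leq le andbT -[X in _ <= coxeter_length X]invgK le.
Qed.

(** Exchanging two consecutive values changes the relative order at one pair of positions only, so
    every inversion survives and the pair holding [a] and [b] is a new one. *)
Lemma coxeter_length_asc_val (n : nat) (x : 'S_n) (a b : 'I_n) :
  (b : nat) = a.+1 -> x^-1%g a < x^-1%g b ->
  coxeter_length x < coxeter_length (x * tperm a b).
Proof.
move=> ab hx; apply/proper_card/properP; split.
  apply/fintype.subsetP => -[i j]; rewrite !inE /= !permM => /andP[ij hij].
  have nij : ~~ ((x j == a :> nat) && (x i == b :> nat)).
    by apply/negP => /andP[/eqP/val_inj ja /eqP/val_inj ib]; move: hx; rewrite -ja -ib !permK; lia.
  rewrite ij /=; move: nij hij.
  by case: (tpermP a b (x j)) => [->|->|/eqP + /eqP];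
    case: (tpermP a b (x i)) => [->|->|/eqP + /eqP]; rewrite -?val_eqE /=; lia.
exists (x^-1%g a, x^-1%g b); rewrite !inE /= ?permM ?permKV ?tpermL ?tpermR hx ab //=.
by rewrite -leqNgt.
Qed.

Lemma coxeter_length_asc_pos (n : nat) (x : 'S_n) (i j : 'I_n) :
  (j : nat) = i.+1 -> x i < x j ->
  coxeter_length x < coxeter_length (tperm i j * x).
Proof.
move=> ij hx; rewrite -coxeter_lengthV -[X in _ < X]coxeter_lengthV invMg tpermV.
by apply: coxeter_length_asc_val; rewrite ?invgK.
Qed.

Lemma coxeter_length_max (n : nat) (x : 'S_n) : coxeter_length x <= n * n.
Proof. by rewrite -{2 3}[n]card_ord -card_prod max_card. Qed.

(** Records what both uses require: the length inequality for a Bruhat step, and the order of the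
    two values and of their positions for the degeneration of Schubert cells. *)
Definition ascent (n : nat) (x y : 'S_n) : Prop :=
  exists a b : 'I_n, [/\ a < b, x^-1%g a < x^-1%g b, y = (x * tperm a b)%g
                       & coxeter_length x < coxeter_length y].

Lemma ascent_bruhat_step (n : nat) (x y : 'S_n) : ascent x y -> bruhat_step x y.
Proof.
move=> [a [b [_ _ -> h]]]; rewrite /bruhat_step h andbT.
by apply/existsP; exists a; apply/existsP; exists b.
Qed.

Lemma ascent_val (n : nat) (x : 'S_n) (a b : 'I_n) :
  (b : nat) = a.+1 -> x^-1%g a < x^-1%g b -> ascent x (x * tperm a b).
Proof.
by move=> ab hx; exists a, b; split=> //; [lia|exact: coxeter_length_asc_val].
Qed.

Lemma ascent_pos (n : nat) (x : 'S_n) (i j : 'I_n) :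
  (j : nat) = i.+1 -> x i < x j -> ascent x (tperm i j * x).
Proof.
move=> ij hx; exists (x i), (x j); split=> //.
- by rewrite !permK; lia.
- by rewrite -tpermJ conjgE mulgA mulgA mulgV mul1g.
- exact: coxeter_length_asc_pos.
Qed.

(** The value at [i] is the number of positions carrying a smaller value, hence is determined by the
    relative order. *)
Lemma perm_eq_order (n : nat) (x y : 'S_n) :
  (forall i j : 'I_n, i < j -> (x i < x j) = (y i < y j)) -> x = y.
Proof.
move=> h; have h' i j : (x i < x j) = (y i < y j).
  case: (ltngtP i j) => [/h //|ji|/val_inj->]; last by rewrite !ltnn.
  have neq (z : 'S_n) : (z i != z j :> nat).
    by rewrite (inj_eq val_inj) (inj_eq perm_inj) -val_eqE /=; lia.
  by have := h _ _ ji; have := neq x; have := neq y; lia.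
have cnt (z : 'S_n) i : #|[set j | z j < z i]| = z i.
  rewrite -(card_imset _ (@perm_inj _ z)).
  have -> : [set z x0 | x0 in [set j | z j < z i]] = [set a : 'I_n | a < z i].
    apply/setP => a; rewrite inE; apply/imsetP/idP => [[j + ->]|ha]; first by rewrite inE.
    by exists (z^-1%g a); rewrite ?inE permKV.
  rewrite -[RHS](card_ord (z i)) -(card_imset _ (_ : injective (widen_ord (ltnW (ltn_ord (z i)))))).
    apply: eq_card => a; rewrite inE; apply/idP/imsetP => [ha|[b _ ->]].
      by exists (Ordinal ha) => //; apply: val_inj.
    by rewrite /= ltn_ord.
  by move=> a b /(congr1 val) /= /val_inj.
apply/permP => i; apply: val_inj; rewrite /= -[LHS]cnt -[RHS]cnt.
by apply: eq_card => j; rewrite !inE h'.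
Qed.

Lemma card_ord_lt (n a : nat) : a <= n -> #|[set j : 'I_n | j < a]| = a.
Proof.
move=> ha; rewrite -[RHS](card_ord a) -(card_imset _ (_ : injective (widen_ord ha))).
  apply: eq_card => j; rewrite inE; apply/idP/imsetP => [hj|[b _ ->]].
    by exists (Ordinal hj) => //; apply: val_inj.
  by rewrite /= ltn_ord.
by move=> b c /(congr1 val) /= /val_inj.
Qed.

Lemma down_closed_card (n : nat) (S : {set 'I_n}) :
  (forall i j : 'I_n, i < j -> j \in S -> i \in S) ->
  forall i : 'I_n, (i \in S) = (i < #|S|).
Proof.
move=> dc i.
have [iS|iS] := boolP (i \in S).
  rewrite -[X in X <= _](card_ord_lt (ltn_ord i)); apply/esym/subset_leq_card/fintype.subsetP => j.
  by rewrite inE ltnS leq_eqVlt => /orP[/eqP/val_inj->//|/dc]; apply.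
apply/esym/negbTE; rewrite -leqNgt -[X in _ <= X](card_ord_lt (ltnW (ltn_ord i))).
apply/subset_leq_card/fintype.subsetP => j jS; rewrite inE ltnNge leq_eqVlt.
apply/negP => /orP[/eqP/val_inj e|/dc/(_ jS)]; last by apply/negP.
by rewrite e jS in iS.
Qed.

Section Ascent.
Variables (n k l : nat).
Implicit Types (x w : 'S_n) (i j a b : 'I_n).

(** The columns of the 1's of the permutation matrix inside the south-west l x k corner; their
    number is the rank of that corner. *)
Definition corner x := [set j : 'I_n | (j < k) && (n - l <= x j)].

(** The longest elements of the double cosets for S_k x S_{n-k} acting on positions and S_{n-l} x
    S_l acting on values. *)
Definition corner_maximal x : Prop :=
  (forall i j, i < j -> (j < k) || (k <= i) -> x j < x i) /\
  (forall a b, a < b -> (b < n - l) || (n - l <= a) -> x^-1%g b < x^-1%g a).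

Lemma corner_maximal_order x : corner_maximal x -> forall i j, i < j ->
  (x i < x j) = [&& i < k, k <= j, x i < n - l & n - l <= x j].
Proof.
move=> [hp hv] i j ij.
have xij : (x i != x j :> nat) by rewrite (inj_eq val_inj) (inj_eq perm_inj) -val_eqE /=; lia.
case h : ((j < k) || (k <= i)); first by have := hp _ _ ij h; lia.
case h' : ((x j < n - l) || (n - l <= x i)); last by lia.
have -> : x i < x j = false; last by lia.
by apply/negP => hx; have := hv _ _ hx h'; rewrite !permK; lia.
Qed.

(** A non-inversion i < j is a pair with i < k outside the corner and j >= k of value at least n -
    l. The corner, and the union [U] of the first k positions with those of value at least n - l,
    are initial segments; inclusion-exclusion makes their sizes depend only on the size of the
    corner, so all non-inversions agree. *)
Lemma corner_maximal_inj x w : corner_maximal x -> corner_maximal w ->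
  #|corner x| = #|corner w| -> x = w.
Proof.
move=> mx mw cxw; apply: perm_eq_order => i j ij.
have hk (y : 'S_n) : corner_maximal y -> forall i, (i \in corner y) = (i < #|corner y|).
  move=> [hp _]; apply: down_closed_card => i' j' ij'; rewrite !inE => /andP[jk hj].
  by have := hp _ _ ij'; rewrite jk => /(_ isT); lia.
pose U (y : 'S_n) := [set j : 'I_n | j < k] :|: [set j | n - l <= y j].
have hU (y : 'S_n) : corner_maximal y -> forall i, (i \in U y) = (i < #|U y|).
  move=> [hp _]; apply: down_closed_card => i' j' ij'; rewrite !inE.
  case: (leqP k i') => /= ki; last by [].
  by have := hp _ _ ij'; rewrite ki orbT => /(_ isT); lia.
have cU (y : 'S_n) : (#|U y| + #|corner y| = #|[set j : 'I_n | j < k]| + #|[set a : 'I_n | n - l <= a]|)%N.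
  have -> : corner y = [set j : 'I_n | j < k] :&: [set j | n - l <= y j].
    by apply/setP => j'; rewrite !inE.
  rewrite cardsUI; congr (_ + _)%N.
  rewrite -(card_imset _ (@perm_inj _ y)); apply: eq_card => a; rewrite inE.
  by apply/imsetP/idP => [[j' + ->]|ha]; [rewrite inE|exists (y^-1%g a); rewrite ?inE permKV].
have e1 : (i \in corner x) = (i \in corner w) by rewrite !hk // cxw.
have e2 : (j \in U x) = (j \in U w) by rewrite !hU //; have := cU x; have := cU w; lia.
by rewrite !corner_maximal_order //; move: e1 e2; rewrite !inE; lia.
Qed.

Lemma decreasing_of_adjacent (f : 'I_n -> nat) (P : nat -> bool) :
  (forall i j, (j : nat) = i.+1 -> P j -> f j < f i) ->
  forall i j, i < j -> (forall c : nat, i < c <= j -> P c) -> f j < f i.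
Proof.
move=> h i j; move: {2}(j - i) (erefl (j - i)) => d; elim: d j => [|d IHd] j dE ij hP.
  by lia.
have hj : j.-1 < n by have := ltn_ord j; lia.
pose j' := Ordinal hj.
have jj' : f j < f j' by apply: h; [rewrite /=; lia|apply: hP; lia].
have [ij'|ij'] := ltnP i j'; last by suff -> : i = j' by []; apply: val_inj; move: ij'; rewrite /=; lia.
apply: ltn_trans jj' _; apply: IHd => //; first by rewrite /=; lia.
by move=> c hc; apply: hP; move: hc; rewrite /=; lia.
Qed.

(** From [x] one climbs by adjacent ascents as long as the corner keeps size at most [r]; the length
    bounds the climb. Swaps of adjacent values other than across n - l do not enlarge the corner,
    and swaps of adjacent positions other than across k preserve its size. So a permutation where
    the climb stops is [corner_maximal], and it is [w] once its corner has size [r]. *)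
Lemma ascent_ind (r : nat) w (K : 'S_n -> Prop) :
  r <= 1 -> (0 < r -> 0 < k /\ 0 < l) ->
  corner_maximal w -> #|corner w| = r ->
  K w -> (forall x y, ascent x y -> K y -> K x) ->
  forall x, #|corner x| <= r -> K x.
Proof.
move=> r1 hr mw cw Kw step x.
have [N] := ubnP (n * n - coxeter_length x); elim: N x => // N IHN x hN cx.
have up y : ascent x y -> #|corner y| <= r -> K x.
  move=> xy cy; apply: (step _ _ xy); apply: IHN => //.
  by case: xy => [a [b [_ _ _ hl]]]; have := coxeter_length_max y; lia.
apply: contrapT => nK.
have nv a b : (b : nat) = a.+1 -> (b : nat) != n - l -> x^-1%g b < x^-1%g a.
  move=> ab bl; rewrite ltnNge leq_eqVlt; apply/negP => /orP[/eqP/val_inj/perm_inj|hlt].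
    by move=> e; move: ab; rewrite e; lia.
  apply: nK; apply: (up _ (ascent_val ab hlt)); apply: leq_trans cx.
  apply/subset_leq_card/fintype.subsetP => j; rewrite !inE permM => /andP[->] /=.
  by case: tpermP => [->|->|_ _] //; lia.
have sw i j y : (j : nat) = i.+1 -> (j : nat) != k ->
    #|corner (tperm i j * y)| = #|corner y|.
  move=> ij jk; rewrite -[RHS](card_imset _ (@perm_inj _ (tperm i j))).
  apply: eq_card => c; rewrite -{2}[c](tpermK i j) mem_imset; last exact: perm_inj.
  rewrite !inE permM; congr (_ && _).
  by case: tpermP => [->|->|//]; lia.
have np i j : (j : nat) = i.+1 -> (j : nat) != k -> x j < x i.
  move=> ij jk; rewrite ltnNge leq_eqVlt; apply/negP => /orP[/eqP/val_inj/perm_inj|hlt].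
    by move=> e; move: ij; rewrite e; lia.
  by apply: nK; apply: (up _ (ascent_pos ij hlt)); rewrite sw.
have mx : corner_maximal x.
  split=> [i j ij hij|a b ab hab].
    apply: (@decreasing_of_adjacent (fun i => x i) (fun c => c != k)) => // c; lia.
  apply: (@decreasing_of_adjacent (fun a => x^-1%g a) (fun c => c != n - l)) => // c; lia.
have [cxr|cxr] := ltnP #|corner x| r; last first.
  apply: nK; rewrite (_ : x = w) //; apply: corner_maximal_inj => //.
  by apply/eqP; rewrite eqn_leq cw cx cxr.
(* With a corner smaller than [r] the swap across [k] is also allowed, since it adds at most the
   position [i]. Then [x] is decreasing, so its first value n - 1 lies in the corner, which [r <= 1]
   forces to be empty. *)
have {}np i j : (j : nat) = i.+1 -> x j < x i.
  move=> ij; have [jk|jk] := eqVneq (j : nat) k; last exact: np.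
  rewrite ltnNge leq_eqVlt; apply/negP => /orP[/eqP/val_inj/perm_inj|hlt].
    by move=> e; move: ij; rewrite e; lia.
  apply: nK; apply: (up _ (ascent_pos ij hlt)); apply: leq_trans cxr.
  apply: leq_trans (_ : #|i |: corner x| <= _); last by rewrite cardsU1; lia.
  apply/subset_leq_card/fintype.subsetP => c; rewrite !inE permM => /andP[ck].
  rewrite ck; case: tpermP => [->|cj|_ _ ->]; rewrite ?eqxx ?orbT //.
  by move: ck; rewrite cj jk ltnn.
have [k0 l0] : 0 < k /\ 0 < l by apply: hr; lia.
have n0 : 0 < n.
  have /card_gt0P[i _] : 0 < #|corner w| by lia.
  by have := ltn_ord i; lia.
have : Ordinal n0 \in corner x.
  rewrite inE k0 /=.
  have hn : n.-1 < n by lia.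
  have e : Ordinal n0 = x^-1%g (Ordinal hn).
    apply: val_inj => /=; apply/eqP; rewrite eq_sym -leqn0 leqNgt; apply/negP => h0.
    have : x (x^-1%g (Ordinal hn)) < x (Ordinal n0).
      by apply: (@decreasing_of_adjacent (fun i => x i) xpredT) => // i j ij _; apply: np.
    by rewrite permKV /=; have := ltn_ord (x (Ordinal n0)); lia.
  by rewrite e permKV /=; lia.
rewrite (_ : corner x = finset.set0) ?inE //.
by apply/eqP; rewrite -cards_eq0; lia.
Qed.

End Ascent.

(** * One-line forms of v and w *)

Lemma size_decreasing_run b a : size (decreasing_run b a) = b.+1 - a.
Proof. by rewrite size_rev size_iota. Qed.

Lemma nth_decreasing_run b a i : i < b.+1 - a -> nth 0 (decreasing_run b a) i = b - i.
Proof.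
by move=> hi; rewrite nth_rev ?size_iota // nth_iota ?subnSK //; lia.
Qed.

Lemma nth_one_line (n : nat) (s : 'S_n) (i : 'I_n) : nth 0 (one_line s) i = (s i).+1.
Proof. by rewrite (nth_map i) ?size_enum_ord ?nth_ord_enum. Qed.

Lemma base_permutationE (n m : nat) (v : 'S_n) : m + 1 <= n -> base_permutation m v ->
  forall j : 'I_n, (v j : nat) = if j <= m then n - m - 1 + j else n - 1 - j.
Proof.
move=> mn hv j; apply: succn_inj; rewrite -nth_one_line hv nth_cat size_iota.
have jn := ltn_ord j; have -> : n.+1 - (n - m) = m.+1 by lia.
by rewrite ltnS; case: ifP => jm; rewrite ?nth_iota ?nth_decreasing_run; lia.
Qed.

(* The two families of the statement: [r = 0] is the marginal one, [r = 1] the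
   conditional one. *)
Definition CI_permutation (n r k l : nat) (w : 'S_n) : Prop :=
  one_line w = decreasing_run n (n - r + 1)
    ++ decreasing_run (n - l) (n - l - k + r + 1)
    ++ decreasing_run (n - r) (n - l + 1) ++ decreasing_run (n - l - k + r) 1.

Lemma CI_permutationE (n m r k l : nat) (w : 'S_n) :
  m + 1 <= n -> r <= k -> r <= l -> k + l <= m + r -> r <= 1 -> CI_permutation r k l w ->
  forall i : 'I_n, (w i : nat) =
    if i < r then n - 1 - i else if i < k then n - 1 - l + r - i
    else if i < k + l - r then n - 1 - r + k - i else n - 1 - i.
Proof.
move=> mn rk rl klm r1 hw i; apply: succn_inj; rewrite -nth_one_line hw.
have hi := ltn_ord i.
rewrite !nth_cat !size_decreasing_run.
have -> : n.+1 - (n - r + 1) = r by lia.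
have -> : (n - l).+1 - (n - l - k + r + 1) = k - r by lia.
have -> : (n - r).+1 - (n - l + 1) = l - r by lia.
have [ir|ir] := ltnP i r; first by rewrite nth_decreasing_run; lia.
have -> : (i - r < k - r) = (i < k) by lia.
have [ik|ik] := ltnP i k; first by rewrite nth_decreasing_run; lia.
have -> : i - r - (k - r) = i - k by lia.
have -> : (i - k < l - r) = (i < k + l - r) by lia.
have [il|il] := ltnP i (k + l - r); first by rewrite nth_decreasing_run; lia.
by rewrite nth_decreasing_run; lia.
Qed.

Lemma CI_permutation_maximal (n m r k l : nat) (w : 'S_n) :
  m + 1 <= n -> r <= k -> r <= l -> k + l <= m + r -> r <= 1 -> CI_permutation r k l w ->
  corner_maximal k l w /\ #|corner k l w| = r.
Proof.
move=> mn rk rl klm r1 hw; have wE := CI_permutationE mn rk rl klm r1 hw.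
split; last first.
  rewrite -[RHS](@card_ord_lt n r); last by lia.
  apply: eq_card => i; rewrite !inE wE; have := ltn_ord i.
  by do 3?case: ifP; lia.
split=> [i j ij hij|a b ab hab].
  by rewrite !wE; have := ltn_ord j; do 6?case: ifP; lia.
have ai := wE (w^-1%g a); have bi := wE (w^-1%g b); rewrite permKV in ai; rewrite permKV in bi.
move: ai bi; have := ltn_ord (w^-1%g a); have := ltn_ord (w^-1%g b).
by do 6?case: ifP; lia.
Qed.

(** On the first k positions v is at most n - l - 2 + r, and the swap raises only the value [a], by
    one. So only the position of [a] can enter the corner, and only for r = 1. *)
Lemma base_corner (n m r k l : nat) (v : 'S_n) (a b : 'I_n) :
  m + 1 <= n -> k + l <= m + r -> base_permutation m v -> r <= 1 ->
  (b : nat) = a.+1 -> n - m - 1 <= a -> #|corner k l (v * tperm a b)| <= r.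
Proof.
move=> mn klm hv r1 ab pa; have vE := base_permutationE mn hv.
have h (j : 'I_n) : j \in corner k l (v * tperm a b) -> r = 1 /\ j = v^-1%g a.
  rewrite inE permM => /andP[jk]; have := vE j; have -> /= : j <= m by lia.
  case: tpermP => [ja|jb|_ _] hj hl; [|by exfalso; move: hl hj; rewrite jb; lia|by exfalso; lia].
  by split; [move: hl hj; rewrite ja; lia|rewrite -ja permK].
have [r0|r0] := posnP r.
  by rewrite r0 leqn0 cards_eq0; apply/eqP/setP => j; rewrite [RHS]inE; apply/negP => /h[]; lia.
apply: leq_trans (_ : #|[set v^-1%g a]| <= _); last by rewrite cards1.
by apply/subset_leq_card/fintype.subsetP => j /h[_ ->]; rewrite inE.
Qed.

Lemma bruhat_le_corner (n m r k l : nat) (w x : 'S_n) :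
  m + 1 <= n -> r <= k -> r <= l -> k + l <= m + r -> r <= 1 -> CI_permutation r k l w ->
  #|corner k l x| <= r -> bruhat_le x w.
Proof.
move=> mn rk rl klm r1 hw; have [mw cw] := CI_permutation_maximal mn rk rl klm r1 hw.
apply: (@ascent_ind n k l r w (fun x => bruhat_le x w)) => //; first by lia.
  exact: connect0.
by move=> {}x y /ascent_bruhat_step xy; apply: connect_trans (connect1 xy).
Qed.

Lemma marginal_CI_caseP (n m : nat) (w : 'S_n) (A B C : {set 'I_m}) : m + 1 <= n ->
  marginal_CI_case w A B C ->
  exists k l, [/\ k + l <= m, CI_permutation 0 k l w & #|A| * #|B| = k * l].
Proof.
move=> mn [k [l [lk hw -> -> _]]]; exists k, l; split; first by lia.
  have nil_run : decreasing_run n (n + 1) = [::].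
    by rewrite /decreasing_run /increasing_run addn1 subnn.
  by rewrite /CI_permutation hw !addn0 subn0 nil_run.
have -> : segment m 1 k = [set j : 'I_m | j < k] by apply/setP => j; rewrite !inE.
have -> : segment m (m - l + 1) m = ~: [set j : 'I_m | j < m - l].
  by apply/setP => j; rewrite !inE; have := ltn_ord j; lia.
by rewrite [X in _ * X]cardsCs finset.setCK card_ord !card_ord_lt ?subKn //; lia.
Qed.

Lemma conditional_CI_caseP (n m : nat) (w : 'S_n) (A B C : {set 'I_m}) : m + 1 <= n ->
  conditional_CI_case w A B C ->
  exists k l, [/\ 0 < k, 0 < l, k + l <= m + 1, CI_permutation 1 k l w
    & #|A| * #|B| = k.-1 * l.-1].
Proof.
move=> mn [s [t [st hw -> -> _]]]; exists s.+1, t.+1; split=> //; first by lia.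
  rewrite /CI_permutation hw; congr (_ ++ _ ++ _ ++ _).
  - by rewrite subnK ?/decreasing_run ?/increasing_run ?subSnn //; lia.
  - congr decreasing_run; lia.
  - congr decreasing_run; lia.
  - congr decreasing_run; lia.
have -> : segment m 1 (1 + s - 1) = [set j : 'I_m | j < s].
  by apply/setP => j; rewrite !inE; lia.
have -> : segment m (1 + s + 1) m = ~: [set j : 'I_m | j < s.+1].
  by apply/setP => j; rewrite !inE; have := ltn_ord j; lia.
rewrite [X in _ * X]cardsCs finset.setCK card_ord !card_ord_lt; [|lia..].
by congr (_ * _); lia.
Qed.

Local Open Scope ring_scope.

(** * Polynomial functions on matrices *)

Lemma poly_nonroot (F : numFieldType) (p : {poly F}) :
  p != 0 -> exists t, p.[t] != 0.
Proof.
move=> p0; apply: contrapT => h.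
pose rs : seq F := [seq i%:R | i <- iota 0 (size p)].
have rs_roots : all (root p) rs.
  apply/allP => t _; rewrite /root; apply: contrapT => /negP ht.
  by apply: h; exists t.
have rs_uniq : uniq rs.
  rewrite map_inj_uniq ?iota_uniq // => i j /eqP.
  by rewrite eqr_nat => /eqP.
by have := max_poly_roots p0 rs_roots rs_uniq; rewrite size_map size_iota ltnn.
Qed.

(** Induction on the number of variables: the polynomial is viewed in its last variable, a nonzero
    coefficient is kept nonzero by specialising the others, and a nonzero univariate polynomial
    remains. The map [W] forgets the last exponent. *)
Lemma mpoly_nonroot (F : numFieldType) (n : nat) (p : {mpoly F[n]}) :
  p != 0 -> exists v, p.@[v] != 0.
Proof.
elim: n p => [|n IHn] p p0.
  exists (fun=> 0); apply: contra_neq p0 => h.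
  have e : p = (p@_0)%:MP.
    by apply: msize1_polyC; rewrite msizeE; apply/bigmax_leqP_seq => m _ _;
       rewrite mdegE big_ord0.
  by rewrite e mevalC in h; rewrite e h.
have [m0 hm0] : exists m, p@_m != 0.
  apply: contrapT => h; move/eqP: p0; apply; apply/mpolyP => m.
  by rewrite mcoeff0; apply: contrapT => /eqP e; apply: h; exists m.
pose W := fun m : 'X_{1..n.+1} => [multinom m (widen_ord (leqnSn n) i) | i < n].
have injW m m' : W m = W m' -> m ord_max = m' ord_max -> m = m'.
  move=> e1 e2; apply/mnmP => i.
  case: (unliftP ord_max i) => [j ->|-> //].
  have -> : lift ord_max j = widen_ord (leqnSn n) j.
    by apply: val_inj; rewrite /= /bump leqNgt ltn_ord.
  by have /mnmP/(_ j) := e1; rewrite !mnmE.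
pose q := (muni p)`_(m0 ord_max).
have q0 : q != 0.
  apply: contra_neq hm0 => hq.
  have : q@_(W m0) = p@_m0.
    rewrite /q muniE coef_sum raddf_sum /=.
    transitivity (\sum_(m <- msupp p) (if m == m0 then p@_m else 0)).
      apply: eq_bigr => m _; rewrite coefZ coefXn.
      case: (eqVneq m m0) => [->|mm0]; first by rewrite eqxx mulr1 mcoeffZ mcoeffX eqxx mulr1.
      case: eqP => [e|_]; last by rewrite mulr0 mcoeff0.
      rewrite mulr1 mcoeffZ mcoeffX; case: eqP => [e'|_]; last by rewrite mulr0.
      by case/eqP: mm0; apply: injW; [exact: e'|exact: esym].
    rewrite -big_mkcond /=; case: (boolP (m0 \in msupp p)) => [m0s|m0s].
      by rewrite (big_rem _ m0s) /= eqxx big_seq_cond big1 ?addr0 // => m;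
        rewrite mem_rem_uniq ?msupp_uniq // inE => /andP[/andP[/negbTE ->]].
    rewrite big_seq_cond big1 => [|m]; first by apply/esym/eqP; rewrite mcoeff_eq0.
    by case: eqP => [->|]; rewrite ?andbF // (negbTE m0s).
  by rewrite hq mcoeff0.
have [v hv] := IHn _ q0.
have r0 : map_poly (meval v) (muni p) != 0.
  apply: contra_neq hv => h.
  by have := congr1 (fun r : {poly F} => r`_(m0 ord_max)) h; rewrite coef_map coef0.
have [t ht] := poly_nonroot r0.
exists (fun i => if unlift ord_max i is Some j then v j else t).
apply: contra_neq ht => h; rewrite -h muniE raddf_sum /= horner_sum mevalE.
apply: eq_bigr => m _.
rewrite map_polyZ /= map_polyXn hornerZ hornerXn mevalZ mevalX big_ord_recr /=.
rewrite unlift_none mulrA; congr (_ * _ * _).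
apply: eq_bigr => i _; rewrite mnmE.
have -> : widen_ord (leqnSn n) i = lift ord_max i.
  by apply: val_inj; rewrite /= /bump leqNgt ltn_ord.
by rewrite liftK.
Qed.

Section PolynomialFunctions.
Variables (R : realType) (n : nat).
Local Notation C := (complex R).
Implicit Types (f h : 'M[C]_n -> C) (x g : 'M[C]_n).

(** [msize] is the total degree plus one. A predicate on functions bounds the degree of a composite
    without writing the composite polynomial down. *)
Definition pdeg (e : nat) f :=
  exists2 p : {mpoly C[n * n]}, (msize p <= e.+1)%N & forall g, f g = eval_poly_mx p g.

Lemma pdeg_le e e' f : (e <= e')%N -> pdeg e f -> pdeg e' f.
Proof. by move=> le [p hp fp]; exists p => //; apply: leq_trans hp _. Qed.

Lemma eq_pdeg e f h : f =1 h -> pdeg e f -> pdeg e h.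
Proof. by move=> fh [p hp fp]; exists p => // g; rewrite -fh. Qed.

Lemma pdeg_const e (c : C) : pdeg e (fun=> c).
Proof.
exists c%:MP; last by move=> g; rewrite /eval_poly_mx mevalC.
by rewrite msizeC; case: eqP.
Qed.

Lemma pdeg_entry i j : pdeg 1 (fun g => g i j).
Proof.
exists 'X_(mxvec_index i j); first by rewrite msizeX mdeg1.
by move=> g; rewrite /eval_poly_mx mevalXU mxvecE.
Qed.

Lemma pdegD e f h : pdeg e f -> pdeg e h -> pdeg e (fun g => f g + h g).
Proof.
move=> [p hp fp] [q hq hhq]; exists (p + q).
  by apply: leq_trans (msizeD_le _ _) _; rewrite geq_max hp.
by move=> g; rewrite fp hhq /eval_poly_mx mevalD.
Qed.

Lemma pdegM e e' f h : pdeg e f -> pdeg e' h -> pdeg (e + e') (fun g => f g * h g).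
Proof.
move=> [p hp fp] [q hq hhq]; exists (p * q).
  have [->|p0] := eqVneq p 0; first by rewrite mul0r msize0.
  have [->|q0] := eqVneq q 0; first by rewrite mulr0 msize0.
  apply: (@leq_trans (e.+1 + e'.+1).-1); last by rewrite addSn addnS.
  by rewrite msizeM // -!subn1 leq_sub2r // leq_add.
by move=> g; rewrite fp hhq /eval_poly_mx mevalM.
Qed.

Lemma pdegX e k f : pdeg e f -> pdeg (k * e) (fun g => f g ^+ k).
Proof.
move=> fe; elim: k => [|k IHk]; first exact: pdeg_const.
by apply: eq_pdeg (pdegM fe IHk) => g; rewrite exprS.
Qed.

Lemma pdeg_sum (I : Type) (r : seq I) (P : pred I) e (F : I -> 'M[C]_n -> C) :
  (forall i, P i -> pdeg e (F i)) -> pdeg e (fun g => \sum_(i <- r | P i) F i g).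
Proof.
move=> hF; elim: r => [|i r IHr].
  by apply: eq_pdeg (pdeg_const _ 0) => g; rewrite big_nil.
have [Pi|nPi] := boolP (P i).
  by apply: eq_pdeg (pdegD (hF i Pi) IHr) => g; rewrite big_cons Pi.
by apply: eq_pdeg IHr => g; rewrite big_cons (negbTE nPi).
Qed.

Lemma pdeg_prod (I : Type) (r : seq I) (P : pred I) (e : I -> nat) (F : I -> 'M[C]_n -> C) :
  (forall i, P i -> pdeg (e i) (F i)) ->
  pdeg (\sum_(i <- r | P i) e i) (fun g => \prod_(i <- r | P i) F i g).
Proof.
move=> hF; elim: r => [|i r IHr].
  by apply: eq_pdeg (pdeg_const _ 1) => g; rewrite big_nil.
rewrite big_cons; have [Pi|nPi] := boolP (P i).
  by apply: eq_pdeg (pdegM (hF i Pi) IHr) => g; rewrite big_cons Pi.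
by apply: eq_pdeg IHr => g; rewrite big_cons (negbTE nPi).
Qed.

Lemma pdeg_comp e c f (phi : 'M[C]_n -> 'M[C]_n) :
  pdeg e f -> (forall i j, pdeg c (fun g => phi g i j)) ->
  pdeg (e * c) (fun g => f (phi g)).
Proof.
move=> [p hp fp] hphi.
apply: (@eq_pdeg _ (fun g => \sum_(m <- msupp p | m \in msupp p)
   p@_m * \prod_k mxvec (phi g) 0 k ^+ m k)).
  by move=> g; rewrite fp /eval_poly_mx mevalE -big_seq.
apply: pdeg_sum => m /msize_mdeg_lt hm.
rewrite -[(e * c)%N]add0n; apply: pdegM; first exact: pdeg_const.
apply: (@pdeg_le (\sum_k m k * c)).
  by rewrite -big_distrl /= -mdegE leq_mul2r; apply/orP; right; lia.
apply: pdeg_prod => k _; apply: pdegX.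
by case/mxvec_indexP: k => i j; apply: eq_pdeg (hphi i j) => g; rewrite mxvecE.
Qed.

Definition polyfun f := exists e, pdeg e f.

Lemma polyfun_eval (p : {mpoly C[n * n]}) : polyfun (eval_poly_mx p).
Proof. by exists (msize p), p. Qed.

Lemma polyfunP f : polyfun f -> exists p : {mpoly C[n * n]}, f = eval_poly_mx p.
Proof. by move=> [e [p _ fp]]; exists p; apply/funext. Qed.

Lemma eq_polyfun f h : f =1 h -> polyfun f -> polyfun h.
Proof. by move=> fh [e /(eq_pdeg fh) hf]; exists e. Qed.

Lemma polyfun_const (c : C) : polyfun (fun=> c).
Proof. by exists 0%N; exact: pdeg_const. Qed.

Lemma polyfun_entry i j : polyfun (fun g => g i j).
Proof. by exists 1%N; exact: pdeg_entry. Qed.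

Lemma polyfunD f h : polyfun f -> polyfun h -> polyfun (fun g => f g + h g).
Proof.
move=> [e fe] [e' he']; exists (maxn e e').
by apply: pdegD; [apply: pdeg_le fe|apply: pdeg_le he']; rewrite ?leq_maxl ?leq_maxr.
Qed.

Lemma polyfunM f h : polyfun f -> polyfun h -> polyfun (fun g => f g * h g).
Proof. by move=> [e fe] [e' he']; exists (e + e')%N; apply: pdegM. Qed.

Lemma polyfunB f h : polyfun f -> polyfun h -> polyfun (fun g => f g - h g).
Proof.
move=> hf hh; apply: polyfunD hf _.
by apply: eq_polyfun (polyfunM (polyfun_const (-1)) hh) => g; rewrite mulN1r.
Qed.

Lemma polyfun_sum (I : finType) (F : I -> 'M[C]_n -> C) :
  (forall i, polyfun (F i)) -> polyfun (fun g => \sum_i F i g).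
Proof.
move=> /choice[e he]; exists (\max_i e i); apply: pdeg_sum => i _.
by apply: pdeg_le (he i); rewrite leq_bigmax.
Qed.

Lemma polyfun_prod (I : finType) (F : I -> 'M[C]_n -> C) :
  (forall i, polyfun (F i)) -> polyfun (fun g => \prod_i F i g).
Proof. by move=> /choice[e he]; exists (\sum_i e i); apply: pdeg_prod => i _. Qed.

Definition polymap (phi : 'M[C]_n -> 'M[C]_n) :=
  forall i j, polyfun (fun g => phi g i j).

Lemma polymap_deg phi : polymap phi ->
  exists c, forall i j, pdeg c (fun g => phi g i j).
Proof.
move=> hphi; have /choice[e he] : forall ij, exists e, pdeg e (fun g => phi g ij.1 ij.2).
  by move=> ij; apply: hphi.
exists (\max_ij e ij) => i j; apply: pdeg_le (he (i, j)); exact: leq_bigmax.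
Qed.

Lemma polyfun_comp f phi : polyfun f -> polymap phi -> polyfun (fun g => f (phi g)).
Proof.
move=> [e fe] /polymap_deg[c hc]; exists (e * c)%N; exact: pdeg_comp.
Qed.

Lemma polymap_id : polymap (fun g => g).
Proof. by move=> i j; exact: polyfun_entry. Qed.

Lemma polymap_const g : polymap (fun=> g).
Proof. by move=> i j; exact: polyfun_const. Qed.

Lemma polymap_mulmx phi psi : polymap phi -> polymap psi ->
  polymap (fun g => phi g *m psi g).
Proof.
move=> hphi hpsi i j.
apply: (@eq_polyfun (fun g => \sum_k phi g i k * psi g k j)).
  by move=> g; rewrite mxE.
by apply: polyfun_sum => k; apply: polyfunM.
Qed.

(** The polynomial ring is a domain, and over an infinite field only the zero polynomial vanishes at
    every point. *)
Lemma polyfun_domain f h x0 : polyfun f -> polyfun h ->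
  (forall x, f x * h x = 0) -> h x0 != 0 -> forall x, f x = 0.
Proof.
move=> /polyfunP[p ->] /polyfunP[q ->] pq hq x.
suff : p * q = 0.
  move/eqP; rewrite mulf_eq0 => /orP[/eqP->|/eqP q0]; first by rewrite /eval_poly_mx meval0.
  by rewrite q0 /eval_poly_mx meval0 eqxx in hq.
apply: contrapT => /eqP/mpoly_nonroot[v /eqP]; apply.
have := pq (vec_mx (\row_k v k)).
rewrite /eval_poly_mx vec_mxK -mevalM => <-.
by apply: meval_eq => k; rewrite mxE.
Qed.

(* A polynomial of degree at most E in the coordinates in [act j] has at most
   E.+1 ^ d coefficients. *)
Lemma independent_card (T J : finType) (act : J -> {set 'I_n * 'I_n}) (E d : nat)
    (f : T -> J -> 'M[C]_n -> C) :
  (forall j, #|act j| <= d)%N -> (forall t j, pdeg E (f t j)) ->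
  (forall la : T -> C,
    (forall j x, (forall a b, (a, b) \notin act j -> x a b = 0) ->
       \sum_t la t * f t j x = 0) -> forall t, la t = 0) ->
  (#|T| <= #|J| * E.+1 ^ d)%N.
Proof.
move=> hd fE indep; rewrite leqNgt; apply/negP => hlt.
have /choice[p hp] : forall tj : T * J, exists p : {mpoly C[n * n]},
    (msize p <= E.+1)%N /\ forall g, f tj.1 tj.2 g = eval_poly_mx p g.
  by move=> [t j]; case: (fE t j) => q; exists q.
pose D j := [set mxvec_index a.1 a.2 | a in act j].
pose P := [set jc : J * {ffun 'I_(n * n) -> 'I_E.+1} |
            jc.2 \in pffun_on ord0 (mem (D jc.1)) predT].
have cardP : (#|P| <= #|J| * E.+1 ^ d)%N.
  apply: (@leq_trans (\sum_(j : J) E.+1 ^ d)%N); last by rewrite sum_nat_const.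
  have -> : #|P| = (\sum_(j : J) #|pffun_on (@ord0 E) (mem (D j)) predT|)%N.
    rewrite -sum1_card (eq_bigl (fun jc : J * {ffun 'I_(n * n) -> 'I_E.+1} =>
      true && (jc.2 \in pffun_on ord0 (mem (D jc.1)) predT))).
      rewrite -(pair_big_dep predT (fun j (c : {ffun 'I_(n * n) -> 'I_E.+1}) =>
        c \in pffun_on ord0 (mem (D j)) predT) (fun _ _ => 1%N)) /=.
      by apply: eq_bigr => j _; rewrite sum1_card.
    by move=> jc; rewrite inE.
  apply: leq_sum => j _; rewrite card_pffun_on card_ord leq_pexp2l //.
  exact: leq_trans (leq_imset_card _ _) _.
pose mon (c : {ffun 'I_(n * n) -> 'I_E.+1}) : 'X_{1..n * n} :=
  [multinom (c k : nat) | k < n * n].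
pose A := \matrix_(t < #|T|, jc < #|P|)
  (p (enum_val t, (enum_val jc).1))@_(mon (enum_val jc).2).
(* With more functions than pairs of a chart and a monomial, some nonzero combination has zero
   coefficient, for each chart, at every monomial in the active coordinates. It vanishes on all the
   coordinate subspaces, against [indep]. *)
have [u uA u0] : exists2 u : 'rV[C]_#|T|, u *m A = 0 & u != 0.
  have : (\rank A < #|T|)%N.
    exact: leq_ltn_trans (rank_leq_col _) (leq_ltn_trans cardP hlt).
  rewrite -subn_gt0 -mxrank_ker lt0n mxrank_eq0 => /rowV0Pn[u hu u0].
  by exists u => //; apply/sub_kermxP.
case/eqP: u0; apply/rowP => t0; rewrite mxE.
rewrite -[t0]enum_valK.
apply: (indep (fun t => u 0 (enum_rank t))) => j x hx.
transitivity (eval_poly_mx (\sum_t u 0 (enum_rank t) *: p (t, j)) x).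
  rewrite /eval_poly_mx raddf_sum; apply: eq_bigr => t _ /=.
  by rewrite mevalZ; have [_ ->] := hp (t, j).
set q := \sum_t _.
have szq : (msize q <= E.+1)%N.
  apply: leq_trans (msize_sum _ _ _) _; apply/bigmax_leqP => t _.
  by apply: leq_trans (msizeZ_le _ _) _; have [] := hp (t, j).
rewrite /eval_poly_mx mevalE big_seq big1 // => m hm.
have [/existsP[k /andP[k1 k2]]|] := boolP [exists k, (k \notin D j) && (m k != 0)%N].
  rewrite (bigD1 k) //=; suff -> : mxvec x 0 k = 0.
    by rewrite expr0n (negbTE k2) mul0r mulr0.
  move: k1; case/mxvec_indexP: k {k2} => a b hab; rewrite mxvecE hx //.
  by apply: contra hab => hab; apply/imsetP; exists (a, b).
rewrite negb_exists => /forallP hsupp.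
have mE k : (m k < E.+1)%N.
  apply: leq_trans szq; apply: leq_trans (msize_mdeg_lt hm).
  by rewrite ltnS mdegE (bigD1 k) //= leq_addr.
pose c := [ffun k => Ordinal (mE k)].
have monc : mon c = m by apply/mnmP => k; rewrite mnmE ffunE.
have cP : (j, c) \in P.
  rewrite inE /=; apply/pffun_onP; split; last by [].
  apply/fintype.subsetP => k; rewrite !inE ffunE -val_eqE /= => mk; have := hsupp k.
  by rewrite mk andbT negbK.
suff -> : q@_m = 0 by rewrite mul0r.
have := congr1 (fun M : 'rV_#|P| => M 0 (enum_rank_in cP (j, c))) uA.
rewrite !mxE => <-; rewrite /q raddf_sum /= (reindex_onto enum_rank enum_val) /=; last first.
  by move=> t _; rewrite enum_valK.
apply: eq_big => t; first by rewrite enum_rankK eqxx.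
by move=> _; rewrite mcoeffZ mxE enum_rankK enum_rankK_in // monc.
Qed.

End PolynomialFunctions.

(** * Closed subsets of the flag variety *)

Section Borel.
Variables (R : realType) (n : nat).
Local Notation C := (complex R).
Implicit Types (g u b x : 'M[C]_n) (Q : 'M[C]_n -> Prop).

Definition upper b := forall i j : 'I_n, (j < i)%N -> b i j = 0.

Lemma upper_borelP b : upper_borel b <-> GL b /\ upper b.
Proof.
split=> [[gb /is_trig_mxP h]|[gb h]]; split=> //.
  by move=> i j ji; have := h _ _ ji; rewrite mxE.
by apply/is_trig_mxP => i j ij; rewrite mxE h.
Qed.

Lemma det_upper u : upper u -> \det u = \prod_i u i i.
Proof.
move=> hu; rewrite -det_tr det_trig; first by apply: eq_bigr => i _; rewrite mxE.
by apply/is_trig_mxP => i j ij; rewrite mxE hu.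
Qed.

Lemma upper_GL u : upper u -> (GL u <-> forall i, u i i != 0).
Proof.
move=> hu; rewrite /GL /= unitmxE det_upper // unitfE.
by split=> [/prodf_neq0 h i|h]; [exact: h|apply/prodf_neq0 => i _; exact: h].
Qed.

Lemma GL1 : GL (1%:M : 'M[C]_n).
Proof. by rewrite /GL /= unitmx1. Qed.

Lemma GLM g b : GL g -> GL b -> GL (g *m b).
Proof. by rewrite /GL /= unitmx_mul => -> ->. Qed.

Lemma upperM u b : upper u -> upper b -> upper (u *m b).
Proof.
move=> hu hb i j ji; rewrite mxE big1 // => k _.
have [ki|ik] := ltnP k i; first by rewrite hu ?mul0r.
by rewrite hb ?mulr0 //; apply: leq_trans ji ik.
Qed.

(** Induction from the last row upwards: below the diagonal, the product of [u] and its inverse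
    reduces to a single term, whose factor [u i i] is nonzero. *)
Lemma upperV u : GL u -> upper u -> upper (invmx u).
Proof.
move=> gu hu i j ji; have d := (upper_GL hu).1 gu.
have [N] := ubnP (n - i)%N; elim: N i ji => // N IHN i ji hN.
have := congr1 (fun b : 'M_n => b i j) (mulmxV gu).
rewrite !mxE (bigD1 i) //= big1 ?addr0 => [|k ki].
  have -> : (i == j) = false by rewrite -val_eqE /=; lia.
  by move/eqP; rewrite mulf_eq0 (negbTE (d i)) => /eqP.
move: ki; rewrite -val_eqE /= => ki.
have [lki|lik] := ltnP k i; first by rewrite hu ?mul0r.
by rewrite IHN ?mulr0 //; have := ltn_ord k; lia.
Qed.

Lemma borel1 : upper_borel (1%:M : 'M[C]_n).
Proof.
apply/upper_borelP; split; first exact: GL1.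
by move=> i j ji; rewrite mxE -val_eqE /=; case: eqP => //; lia.
Qed.

Lemma borelM u b : upper_borel u -> upper_borel b -> upper_borel (u *m b).
Proof.
move=> /upper_borelP[gu hu] /upper_borelP[gb hb]; apply/upper_borelP.
by split; [exact: GLM|exact: upperM].
Qed.

Lemma borelV u : upper_borel u -> upper_borel (invmx u).
Proof.
move=> /upper_borelP[gu hu]; apply/upper_borelP; split; last exact: upperV.
by rewrite /GL /= unitmx_inv.
Qed.

Lemma coset_B_refl g : coset_B g g.
Proof. by exists 1%:M; [exact: borel1|rewrite mulmx1]. Qed.

Lemma coset_BM g u : upper_borel u -> coset_B (g *m u) = coset_B g.
Proof.
move=> hu; apply/seteqP; split=> [_ [b hb <-]|_ [b hb <-]].
  by exists (u *m b); [exact: borelM|rewrite mulmxA].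
exists (invmx u *m b); first by apply: borelM => //; apply: borelV.
by case: hu => gu _; rewrite mulmxA mulmxK.
Qed.

Lemma coset_B_eq g b : coset_B g = coset_B b -> exists2 u, upper_borel u & g = b *m u.
Proof. by move=> e; have := coset_B_refl g; rewrite e => -[u hu <-]; exists u. Qed.

Definition right_invariant Q := forall g u, upper_borel u -> Q g -> Q (g *m u).

Definition cosets Q : set (set 'M[C]_n) :=
  [set X | exists g, [/\ GL g, X = coset_B g & Q g]]%classic.

Lemma cosetsE Q g : right_invariant Q -> GL g -> cosets Q (coset_B g) <-> Q g.
Proof.
move=> rQ gg; split=> [[b [gb e Qb]]|Qg]; last by exists g.
by have [u hu ->] := coset_B_eq e; apply: rQ.
Qed.

Definition zeros (J : set ('M[C]_n -> C)) g := forall f, J f -> f g = 0.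

Definition all_polyfun (J : set ('M[C]_n -> C)) := forall f, J f -> polyfun f.

Lemma flag_closed_cosets Q J : right_invariant Q -> all_polyfun J ->
  (forall g, GL g -> Q g <-> zeros J g) -> flag_closed (cosets Q).
Proof.
move=> rQ pJ QJ; split=> [X [g [gg -> _]]|]; first by exists g.
exists [set p | J (eval_poly_mx p)]%classic; apply/seteqP; split=> g /=.
  move=> [gg]; rewrite cosetsE // QJ // => h; split=> // p; exact: h.
move=> [gg h]; split=> //; apply/cosetsE => //; apply/QJ => // f Jf.
by have [p e] := polyfunP (pJ _ Jf); rewrite e; apply: h; rewrite -e.
Qed.

Lemma flag_closedP F : flag_closed F ->
  exists2 J, all_polyfun J & forall g, GL g -> F (coset_B g) <-> zeros J g.
Proof.
move=> [_ [I hI]]; exists [set f | exists2 p, I p & f = eval_poly_mx p]%classic.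
  by move=> _ [p _ ->]; apply: polyfun_eval.
move=> g gg; have h := congr1 (fun S : set 'M[C]_n => S g) hI.
split=> [Fg _ [p Ip ->]|h'].
  have : [set g | GL g /\ F (coset_B g)]%classic g by [].
  by rewrite hI => -[_]; apply.
have : [set g | GL g /\ F (coset_B g)]%classic g.
  by rewrite hI; split=> // p Ip; apply: h'; exists p.
by case.
Qed.

(** The polynomial functions vanishing on [W] form a prime ideal or everything: the form that
    irreducibility takes for functions. *)
Definition prime_set (W : set 'M[C]_n) := forall f h, polyfun f -> polyfun h ->
  (forall g, W g -> f g * h g = 0) ->
  (forall g, W g -> f g = 0) \/ (forall g, W g -> h g = 0).

(** Pulled back along [phi] and multiplied by [d], a vanishing product vanishes on all matrices,
    where polynomial functions form a domain. The factor [d] admits parametrisations by a nonempty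
    open set. *)
Lemma prime_image (phi : 'M[C]_n -> 'M[C]_n) d x0 (W : set 'M[C]_n) :
  polymap phi -> polyfun d -> d x0 != 0 ->
  (forall x, d x != 0 -> W (phi x)) ->
  (forall g, W g -> exists2 x, d x != 0 & g = phi x) -> prime_set W.
Proof.
move=> hphi hd d0 Wphi phiW f h hf hh fh.
have [[y hy]|hno] := pselect (exists x, h (phi x) * d x != 0); last first.
  right=> g /phiW[x dx ->]; apply: contrapT => /eqP hx; apply: hno.
  by exists x; rewrite mulf_neq0.
left=> g /phiW[x _ ->].
apply: (polyfun_domain (polyfun_comp hf hphi) (polyfunM (polyfun_comp hh hphi) hd) _ hy) => {}x.
have [->|dx] := eqVneq (d x) 0; first by rewrite !mulr0.
by rewrite mulrA fh ?mul0r //; apply: Wphi.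
Qed.

(** Restricted to the matrices with nonzero [diag_prod], this parametrises B. *)
Definition utri x : 'M[C]_n := \matrix_(i, j) if (i <= j)%N then x i j else 0.

Lemma polymap_utri : polymap utri.
Proof.
move=> i j; apply: (@eq_polyfun _ _ (fun x => if (i <= j)%N then x i j else 0)).
  by move=> x; rewrite mxE.
by case: leqP => _; [exact: polyfun_entry|exact: polyfun_const].
Qed.

Lemma upper_utri x : upper (utri x).
Proof. by move=> i j ji; rewrite mxE leqNgt ji. Qed.

Lemma utri_upper u : upper u -> utri u = u.
Proof. by move=> hu; apply/matrixP => i j; rewrite mxE; case: leqP => // /hu. Qed.

Definition diag_prod x : C := \prod_i x i i.

Lemma polyfun_diag_prod : polyfun diag_prod.
Proof. by apply: polyfun_prod => i; apply: polyfun_entry. Qed.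

Lemma diag_prod1 : diag_prod 1%:M != 0.
Proof. by rewrite /diag_prod big1 ?oner_eq0 // => i _; rewrite mxE eqxx. Qed.

Lemma utri_borel x : diag_prod x != 0 -> upper_borel (utri x).
Proof.
move=> /prodf_neq0 h; apply/upper_borelP; split; last exact: upper_utri.
by apply/(upper_GL (upper_utri x)) => i; rewrite mxE leqnn h.
Qed.

Lemma borel_diag_prod u : upper_borel u -> diag_prod u != 0.
Proof. by move=> /upper_borelP[gu hu]; apply/prodf_neq0 => i _; apply: (upper_GL hu).1. Qed.

Lemma prime_coset g : prime_set (coset_B g).
Proof.
apply: (@prime_image (fun x => g *m utri x) diag_prod 1%:M).
- exact: polymap_mulmx (polymap_const _) polymap_utri.
- exact: polyfun_diag_prod.
- exact: diag_prod1.
- by move=> x hx; exists (utri x) => //; apply: utri_borel.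
- move=> _ [u hu <-]; exists u; first exact: borel_diag_prod.
  by rewrite utri_upper //; case/upper_borelP: hu.
Qed.

Definition preimage_GL (Z : set (set 'M[C]_n)) : set 'M[C]_n :=
  [set g | GL g /\ Z (coset_B g)]%classic.

(** The zero set of a function need not be a union of cosets; this is the largest union of cosets
    inside it. *)
Definition vanish_on_coset f g : Prop := forall u, upper_borel u -> f (g *m u) = 0 :> C.

Lemma right_invariant_vanish f : right_invariant (vanish_on_coset f).
Proof. by move=> g u hu h b hb; rewrite -mulmxA; apply: h; apply: borelM. Qed.

Lemma flag_closed_vanish f : polyfun f -> flag_closed (cosets (vanish_on_coset f)).
Proof.
move=> hf; apply: (@flag_closed_cosets _
  [set h | exists2 u, upper_borel u & h = (fun g => f (g *m u))]%classic).
- exact: right_invariant_vanish.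
- move=> _ [u _ ->]; apply: polyfun_comp => //.
  exact: polymap_mulmx (@polymap_id _ _) (polymap_const _).
- by move=> g gg; split=> [h _ [u hu ->]|h u hu]; [exact: h|by apply: (h (fun g => f (g *m u))); exists u].
Qed.

(** A coset is prime, so on each coset of [Z] one of the two factors vanishes identically. This
    covers [Z] by two closed sets, one of which contains it by irreducibility. *)
Lemma prime_preimage (Z : set (set 'M[C]_n)) :
  (Z `<=` @flag_variety R n)%classic -> irreducible (@flag_closed R n) Z -> prime_set (preimage_GL Z).
Proof.
move=> Zfl [_ hZ] f h hf hh fh.
have : (Z `<=` cosets (vanish_on_coset f) `|` cosets (vanish_on_coset h))%classic.
  move=> X ZX; have [g gg e] := Zfl _ ZX; rewrite -e in ZX *.
  have fhg a : coset_B g a -> f a * h a = 0.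
    move=> [u hu <-]; apply: fh; split; first by apply: GLM => //; case: hu.
    by rewrite coset_BM.
  have [h'|h'] := prime_coset hf hh fhg; [left|right];
    apply/cosetsE => //; try exact: right_invariant_vanish;
    move=> u hu; apply: h'; by exists u.
case/(hZ _ _ (flag_closed_vanish hf) (flag_closed_vanish hh)) => hs; [left|right];
  move=> g [gg /hs]; rewrite cosetsE //; try exact: right_invariant_vanish;
  by move=> /(_ _ borel1); rewrite mulmx1.
Qed.

End Borel.

(** * Dimension by growth of polynomial functions *)

Section Growth.
Variables (R : realType) (n : nat).
Local Notation C := (complex R).
Implicit Types (W : set 'M[C]_n) (f h : 'M[C]_n -> C).

(* The Hilbert function of W grows at least like N ^ q: this is how dimensions
   are bounded below without transcendence degrees. *)
Definition growth (q : nat) W : Prop :=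
  exists K : nat, forall N : nat, exists (T : finType) (F : T -> 'M[C]_n -> C),
    [/\ #|T| = (N ^ q)%N, forall t, pdeg (K * N) (F t)
      & forall la : T -> C,
          (forall g, W g -> \sum_t la t * F t g = 0) -> forall t, la t = 0].

Lemma growth_point g W : W g -> growth 0 W.
Proof.
move=> Wg; exists 0%N => N; exists unit, (fun _ _ => 1); split.
- by rewrite card_unit.
- by move=> t; exact: pdeg_const.
- move=> la /(_ _ Wg) h [].
  by rewrite (bigD1 tt) //= big1 ?addr0 ?mulr1 // in h; case.
Qed.

(** The products F_t f^c with c < N are independent on [W']. By induction on c the lower terms of a
    relation are zero; primality allows division by f^c, and on [W], where f vanishes, only the
    coefficient of f^c remains. *)
Lemma growth_step q W W' f : growth q W -> (W `<=` W')%classic -> prime_set W' ->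
  polyfun f -> (forall g, W g -> f g = 0) -> ~ (forall g, W' g -> f g = 0) ->
  growth q.+1 W'.
Proof.
move=> [K hK] WW' pW' [e fe] fW fW'; exists (K + e)%N => N.
have [T [F [cT dF iF]]] := hK N.
exists (T * 'I_N)%type, (fun (tc : T * 'I_N) g => F tc.1 g * f g ^+ tc.2); split.
- by rewrite card_prod card_ord cT expnSr.
- move=> [t c] /=; apply: (@pdeg_le _ _ (K * N + c * e)).
    by rewrite mulnDl leq_add2l mulnC leq_mul2l ltnW ?orbT.
  exact: pdegM (dF t) (pdegX _ fe).
move=> la hla.
have pf g : \sum_tc la tc * (F tc.1 g * f g ^+ tc.2) =
    \sum_(c < N) (\sum_t la (t, c) * F t g) * f g ^+ c.
  rewrite (eq_bigr (fun tc => la (tc.1, tc.2) * (F tc.1 g * f g ^+ tc.2))); last by case.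
  rewrite -(pair_bigA _ (fun t c => la (t, c) * (F t g * f g ^+ c))) /= exchange_big /=.
  by apply: eq_bigr => c _; rewrite mulr_suml; apply: eq_bigr => t _; rewrite mulrA.
suff hc (c : 'I_N) : forall t, la (t, c) = 0 by move=> [t c].
have [M] := ubnP c; elim: M c => // M IHM c hM.
apply: (iF (fun t => la (t, c))) => g Wg.
pose rest g := \sum_(c' < N | (c <= c')%N) (\sum_t la (t, c') * F t g) * f g ^+ (c' - c).
have hrest : forall g, W' g -> rest g = 0.
  have prest : polyfun rest.
    exists (K * N + N * e)%N; apply: pdeg_sum => c' _; apply: pdegM.
      apply: pdeg_sum => t _; rewrite -[(K * N)%N]add0n; apply: pdegM => //.
      exact: pdeg_const.
    apply: pdeg_le (pdegX _ fe); rewrite leq_mul2r; apply/orP; right.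
    by have := ltn_ord c'; lia.
  have pfc : polyfun (fun g => f g ^+ c) by exists (c * e)%N; exact: pdegX.
  have [|h0|//] := pW' _ _ pfc prest.
    move=> g' Wg'; rewrite -[RHS](hla _ Wg') pf (bigID (fun c' : 'I_N => (c <= c')%N)) /=.
    rewrite [X in _ = _ + X]big1 ?addr0 => [|c' cc']; last first.
      rewrite big1 ?mul0r // => t _; rewrite IHM ?mul0r //; lia.
    rewrite mulr_sumr; apply: eq_bigr => c' cc'.
    by rewrite mulrCA -exprD subnKC.
  case: fW' => g' Wg'; have /eqP := h0 _ Wg'.
  by rewrite expf_eq0 => /andP[_ /eqP].
have := hrest g (WW' _ Wg).
rewrite /rest (bigD1 c) //= subnn expr0 mulr1 [X in _ + X]big1 ?addr0 => [|c' /andP[cc' nc]]; first by [].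
by rewrite fW // expr0n; move: nc; rewrite -val_eqE /= => nc; rewrite (_ : _ == 0%N = false) ?mulr0 //; lia.
Qed.

(** The exponent is dim B. The sets [WS S] let the entries in [S] vary and fix the others to those
    of the identity; freeing one entry is a [growth_step] for the function reading that entry of
    g^-1 h. *)
Lemma growth_coset g : GL g ->
  growth #|[set e : 'I_n * 'I_n | (e.1 <= e.2)%N]| (coset_B g).
Proof.
move=> gg.
pose mask (S : {set 'I_n * 'I_n}) (x : 'M[C]_n) : 'M[C]_n :=
  \matrix_(i, j) if (i, j) \in S then x i j else (i == j)%:R.
pose WS (S : {set 'I_n * 'I_n}) : set 'M[C]_n :=
  [set h | exists2 x, diag_prod (mask S x) != 0 & h = g *m mask S x]%classic.
have pmask S : polymap (mask S).
  move=> i j; apply: (@eq_polyfun _ _ (fun x => if (i, j) \in S then x i j else (i == j)%:R)).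
    by move=> x; rewrite mxE.
  by case: ((i, j) \in S); [exact: polyfun_entry|exact: polyfun_const].
have mask1 S : mask S 1%:M = 1%:M.
  by apply/matrixP => i j; rewrite !mxE; case: ifP.
have primeWS S : prime_set (WS S).
  apply: (@prime_image _ _ (fun x => g *m mask S x) (fun x => diag_prod (mask S x)) 1%:M).
  - exact: polymap_mulmx (polymap_const _) (pmask S).
  - exact: polyfun_comp (@polyfun_diag_prod _ _) (pmask S).
  - by rewrite mask1 diag_prod1.
  - by move=> x hx; exists x.
  - by move=> h [x hx ->]; exists x.
have grow (S : {set 'I_n * 'I_n}) : growth #|S| (WS S).
  have [N] := ubnP #|S|; elim: N S => // N IHN S hN.
  have [->|[e eS]] := set_0Vmem S.
    rewrite cards0; apply: (@growth_point g); exists 1%:M; first by rewrite mask1 diag_prod1.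
    by rewrite mask1 mulmx1.
  have SE : #|S| = #|S :\ e|.+1 by rewrite (cardsD1 e) eS.
  rewrite SE.
  apply: (@growth_step #|S :\ e| (WS (S :\ e)) (WS S) (fun h : 'M[C]_n => (invmx g *m h) e.1 e.2 - (e.1 == e.2)%:R)).
  - by apply: IHN; rewrite SE in hN; lia.
  - move=> _ [x hx ->].
    have E : mask (S :\ e) x = mask S (mask (S :\ e) x).
      by apply/matrixP => i j; rewrite !mxE !inE; case: ((i, j) \in S); rewrite ?andbF ?andbT //.
    by exists (mask (S :\ e) x); rewrite -E.
  - exact: primeWS.
  - apply: polyfunB (polyfun_const _ _).
    exact: (polymap_mulmx (polymap_const _) (@polymap_id _ _)).
  - move=> _ [x hx ->]; rewrite mulKmx // mxE !inE -surjective_pairing eqxx /=.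
    by rewrite subrr.
  (* If [e] is diagonal this entry is 2, which is nonzero, so the matrix stays invertible. *)
  - pose x : 'M[C]_n := 1%:M + delta_mx e.1 e.2.
    have hx : diag_prod (mask S x) != 0.
      apply/prodf_neq0 => i _; rewrite !mxE eqxx; case: ifP => _; last exact: oner_neq0.
      by case: (_ && _); rewrite ?addr0 ?oner_neq0 // -[1 + 1]/(2%:R) pnatr_eq0.
    move=> /(_ _ (ex_intro2 _ _ x hx erefl)).
    rewrite mulKmx // !mxE -surjective_pairing eS !eqxx /= addrAC subrr add0r.
    by move/eqP; rewrite oner_eq0.
have -> : coset_B g = WS [set e : 'I_n * 'I_n | (e.1 <= e.2)%N]; last exact: grow.
have mE x : mask [set e : 'I_n * 'I_n | (e.1 <= e.2)%N] x = utri x.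
  apply/matrixP => i j; rewrite !mxE inE /=; case: leqP => // ji.
  by have -> : (i == j) = false by rewrite -val_eqE /=; lia.
apply/seteqP; split=> [_ [u hu <-]|_ [x hx ->]].
  exists u; rewrite mE utri_upper //; try by case/upper_borelP: hu.
  exact: borel_diag_prod.
rewrite mE in hx *; exists (utri x) => //.
apply/upper_borelP; split; last exact: upper_utri.
by apply/(upper_GL (upper_utri x)) => i; move/prodf_neq0: hx; apply.
Qed.

(** Pulled back to the charts, N ^ q independent functions become polynomials of degree O(N) in at
    most d variables, and there are only O(N ^ d) coefficients. *)
Lemma growth_bound (J : finType) (act : J -> {set 'I_n * 'I_n})
    (phi : J -> 'M[C]_n -> 'M[C]_n) (d q : nat) W :
  growth q W -> (forall j, #|act j| <= d)%N -> (forall j, polymap (phi j)) ->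
  (forall g, W g -> exists j (x : 'M[C]_n),
     (forall a b, (a, b) \notin act j -> x a b = 0) /\ g = phi j x) ->
  (q <= d)%N.
Proof.
move=> [K hK] hd hphi hW.
have /choice[c hc] j := polymap_deg (hphi j).
pose D := \max_j c j.
have bound N : (N ^ q <= #|J| * (K * N * D).+1 ^ d)%N.
  have [T [F [<- dF iF]]] := hK N.
  apply: (independent_card (f := fun t j x => F t (phi j x)) hd).
    move=> t j; apply: pdeg_comp (dF t) _ => a b.
    by apply: pdeg_le (hc j a b); exact: leq_bigmax.
  move=> la h; apply: iF => g /hW[j [x [hx ->]]]; exact: h.
rewrite leqNgt; apply/negP => dq.
(* As K N D + 1 <= (K D + 1) N, an exponent q > d would give N <= #|J| (K D + 1) ^ d, which this
   choice contradicts. *)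
pose N := (#|J| * (K * D).+1 ^ d).+1.
have : (N ^ d.+1 <= #|J| * ((K * D).+1 ^ d * N ^ d))%N.
  apply: leq_trans (_ : N ^ q <= _)%N; first by rewrite leq_pexp2l.
  apply: leq_trans (bound N) _; rewrite leq_mul2l; apply/orP; right.
  rewrite -expnMn; have [->|d0] := posnP d; first by [].
  by rewrite leq_exp2r // mulSn mulnAC -add1n leq_add2r.
rewrite mulnA expnS leq_pmul2r ?expn_gt0 //.
by rewrite ltnn.
Qed.

End Growth.

(** * Bruhat decomposition and Schubert varieties *)

Section Bruhat.
Variables (R : realType) (n : nat).
Local Notation C := (complex R).
Implicit Types (g h u b : 'M[C]_n) (x y w : 'S_n).

Lemma mulmx_permutation g x i j : (g *m permutation_matrix R x) i j = g i (x j).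
Proof.
rewrite mxE (bigD1 (x j)) //= !mxE eqxx mulr1 big1 ?addr0 // => k kx.
by rewrite !mxE eq_sym (negbTE kx) mulr0.
Qed.

Lemma GL_permutation x : GL (permutation_matrix R x).
Proof. by rewrite /GL /= unitmx_tr unitmx_perm. Qed.

(** Gaussian elimination from left to right: after j rounds each of the first j columns, and the row
    [s c] of its pivot, is a unit vector. *)
Lemma bruhat_decomposition g : GL g -> exists b x u,
  [/\ upper_borel b, upper_borel u & g = b *m permutation_matrix R x *m u].
Proof.
move=> gg.
have step (j : nat) : (j <= n)%N -> exists b u (s : 'I_n -> 'I_n),
    [/\ upper_borel b, upper_borel u
      & forall c : 'I_n, (c < j)%N ->
          (forall a, (b *m g *m u) a c = (a == s c)%:R) /\
          (forall d, (b *m g *m u) (s c) d = (d == c)%:R)].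
  elim: j => [|j IHj] jn.
    by exists 1%:M, 1%:M, id; split=> //; exact: borel1.
  have [b [u [s [hb hu hs]]]] := IHj (ltnW jn).
  have [h hE] : exists h, h = b *m g *m u by eexists.
  rewrite -hE in hs; pose J := Ordinal jn.
  have gh : GL h by rewrite hE; apply: GLM; [apply: GLM => //; case: hb|case: hu].
  have [i0 hi0] : exists i, h i J != 0.
    apply: contrapT => hno.
    have hJ : h *m delta_mx J (0 : 'I_1) = 0.
      apply/matrixP => a z; rewrite !mxE (bigD1 J) //= big1 ?addr0.
        rewrite mxE eqxx (ord1 z) mulr1; apply: contrapT => /eqP ha; apply: hno.
        by exists a.
      by move=> k kJ; rewrite mxE (negbTE kJ) mulr0.
    have := congr1 (mulmx (invmx h)) hJ; rewrite mulKmx // mulmx0.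
    move/matrixP/(_ J 0); rewrite !mxE !eqxx => /eqP; by rewrite oner_eq0.
  (* The lowest nonzero entry is the pivot: the rows to clear lie above it, so the row operation [L]
     is upper triangular. *)
  pose i := [arg max_(i > i0 | h i J != 0) (i : nat)].
  have [hi imax] : h i J != 0 /\ forall a : 'I_n, (i < a)%N -> h a J = 0.
    rewrite /i; case: arg_maxnP => // i1 hi1 max1; split=> // a ia.
    by apply: contrapT => /eqP/max1; lia.
  have hsc (c : 'I_n) : (c < j)%N -> [/\ (J == c) = false, (i == s c) = false & h i c = 0].
    move=> cj; have [h1 h2] := hs _ cj.
    have Jc : (J == c) = false by rewrite -val_eqE /=; lia.
    have isc : (i == s c) = false.
      by apply/eqP => e; move: hi; rewrite e h2 Jc eqxx.
    by split=> //; rewrite h1 isc.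
  pose L : 'M[C]_n := \matrix_(a, a') if a' == i then (if a == i then (h i J)^-1
                                    else - (h a J / h i J)) else (a == a')%:R.
  have [M hM] : exists M, M = L *m h by eexists.
  have LE a d : M a d = if a == i then h i d / h i J else h a d - h a J * h i d / h i J.
    rewrite hM mxE (bigD1 i) //= !mxE eqxx; have [->|ai] := eqVneq a i.
      by rewrite big1 ?addr0 1?mulrC // => a' a'i; rewrite mxE (negbTE a'i) eq_sym (negbTE a'i) mul0r.
    rewrite (bigD1 a) //= mxE (negbTE ai) eqxx mul1r big1 ?addr0.
      by rewrite addrC mulNr mulrAC.
    by move=> a' /andP[a'i a'a]; rewrite mxE (negbTE a'i) eq_sym (negbTE a'a) mul0r.
  have hL : upper_borel L.
    have uL : upper L.
      move=> a a' a'a; rewrite mxE; case: eqP => [e|_].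
        rewrite -e; have -> : (a == a') = false by rewrite -val_eqE /=; lia.
        by rewrite imax ?mul0r ?oppr0 // -e.
      by have -> : (a == a') = false by rewrite -val_eqE /=; lia.
    apply/upper_borelP; split=> //; apply/(upper_GL uL) => a.
    by rewrite mxE; case: ifP => [->|_]; rewrite ?invr_eq0 ?eqxx ?oner_eq0.
  (* Clears the pivot row by column operations; [V] is upper triangular because that row already
     vanishes left of column [J]. *)
  pose V : 'M[C]_n := \matrix_(d', d) if d' == J then (if d == J then 1
                                    else - M i d) else (d' == d)%:R.
  have VE a d : (M *m V) a d = if d == J then (a == i)%:R
      else if a == i then 0 else h a d - h a J * h i d / h i J.
    have LJ : M a J = (a == i)%:R.
      by rewrite LE; case: eqP => _; rewrite ?divff // mulfK ?subrr.
    rewrite mxE (bigD1 J) //= LJ [V J d]mxE eqxx; have [->|dJ] := eqVneq d J.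
      by rewrite big1 ?addr0 ?mulr1 // => d' d'J; rewrite [V _ _]mxE (negbTE d'J) mulr0.
    rewrite (bigD1 d) //= [V d d]mxE (negbTE dJ) eqxx mulr1 big1 ?addr0.
      rewrite !LE eqxx; case: eqP => _; last by rewrite mul0r add0r.
      by rewrite mul1r addNr.
    by move=> d' /andP[d'J d'd]; rewrite [V _ _]mxE (negbTE d'J) (negbTE d'd) mulr0.
  have hV : upper_borel V.
    have uV : upper V.
      move=> d' d dd'; rewrite mxE; case: eqP => [e|_].
        have -> : (d == J) = false by rewrite -e -val_eqE /=; lia.
        rewrite LE eqxx; have [|_ _ ->] := hsc d; last by rewrite mul0r oppr0.
        by move: dd'; rewrite e.
      by have -> : (d' == d) = false by rewrite -val_eqE /=; lia.
    apply/upper_borelP; split=> //; apply/(upper_GL uV) => d.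
    by rewrite mxE; case: ifP => [->|_]; rewrite ?eqxx oner_eq0.
  exists (L *m b), (u *m V), (fun c => if c == J then i else s c).
  split; [exact: borelM|exact: borelM|].
  move=> c; rewrite ltnS => cj.
  have -> : L *m b *m g *m (u *m V) = M *m V by rewrite hM hE !mulmxA.
  have [->|cJ] := eqVneq c J.
    split=> [a|d]; first by rewrite VE eqxx.
    by rewrite VE eqxx; case: ifP.
  have {}cj : (c < j)%N by rewrite ltn_neqAle cj andbT; move: cJ; rewrite -val_eqE.
  have [Jc isc hic] := hsc _ cj; have [h1 h2] := hs _ cj.
  split=> [a|d]; rewrite VE.
    rewrite (negbTE cJ) hic mulr0 mul0r subr0; case: eqP => [->|_]; last exact: h1.
    by rewrite isc.
  rewrite [s c == i]eq_sym isc !h2 Jc !mul0r subr0.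
  by case: eqP => // ->; rewrite Jc.
have [b [u [s [hb hu hs]]]] := step n (leqnn n).
have sinj : injective s.
  move=> c d e; have [_ h2] := hs c (ltn_ord c); have [_ h3] := hs d (ltn_ord d).
  have := h2 d; rewrite e h3 eqxx; case: (d =P c) => [-> //|_] /eqP.
  by rewrite oner_eq0.
exists (invmx b), (perm sinj), (invmx u); split; try exact: borelV.
have <- : b *m g *m u = permutation_matrix R (perm sinj).
  apply/matrixP => a c; have [-> _] := hs c (ltn_ord c).
  by rewrite !mxE permE eq_sym.
by case: hb => gb _; case: hu => gu _; rewrite -[b *m g *m u]mulmxA mulKmx // mulmxK.
Qed.

(** The curve c -> be (1 + c E_{ba}) x passes through be x at c = 0 and lies in B y B for c nonzero.
    An equation of [F] along it is a polynomial in c vanishing away from 0, hence also at 0. *)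
Lemma schubert_ascent F x y : flag_closed F -> ascent x y ->
  (@schubert_cell R n y `<=` F)%classic -> (@schubert_cell R n x `<=` F)%classic.
Proof.
move=> clF [a [b [ab hx -> _]]] yF _ [be hbe <-].
have [J pJ hJ] := flag_closedP clF.
have gbe : GL be by case: hbe.
apply/hJ; first by apply: GLM => //; exact: GL_permutation.
move=> f Jf.
(* Polynomial functions here take a matrix, so the entry [m a a] serves as the parameter of the
   curve. *)
pose X (m : 'M[C]_n) : 'M[C]_n := \matrix_(p, z) ((p == z)%:R + (m a a) * ((p == b) && (z == a))%:R).
pose phi m := be *m X m *m permutation_matrix R x.
suff : f (phi 0) = 0.
  congr (f _ = 0); rewrite /phi; congr (_ *m _).
  rewrite (_ : X 0 = 1%:M) ?mulmx1 //.
  by apply/matrixP => p z; rewrite !mxE mul0r addr0.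
have pphi : polymap phi.
  apply: polymap_mulmx (polymap_const _); apply: polymap_mulmx (polymap_const _) _ => p z.
  apply: (@eq_polyfun _ _ (fun m : 'M[C]_n => (p == z)%:R + m a a * ((p == b) && (z == a))%:R)).
    by move=> m; rewrite mxE.
  apply: polyfunD (polyfun_const _ _) _.
  exact: polyfunM (@polyfun_entry _ _ a a) (polyfun_const _ _).
apply: (polyfun_domain (polyfun_comp (pJ _ Jf) pphi) (@polyfun_entry _ _ a a) (x0 := 1%:M)); last first.
  by rewrite mxE eqxx oner_eq0.
move=> m; have [->|c0] := eqVneq (m a a) 0; first by rewrite mulr0.
set c := m a a in c0; suff -> : f (phi m) = 0 by rewrite mul0r.
have aneb : (a == b) = false by rewrite -val_eqE /=; lia.
(* From the 2 x 2 identity [[1, 0], [c, 1]] [[1, -1/c], [0, 1]] = [[-1/c, 1], [0, c]] [[0, 1],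
   [1, 0]]. The order of [a] and [b] makes [be'] upper triangular, that of their positions makes [u]
   so. *)
pose be' : 'M[C]_n := \matrix_(p, z) if p == z then (if p == a then - c^-1 else if p == b then c else 1)
                                     else ((p == a) && (z == b))%:R.
pose u : 'M[C]_n := \matrix_(p, q) ((p == q)%:R - c^-1 * ((p == x^-1%g a) && (q == x^-1%g b))%:R).
have hbe' : upper_borel be'.
  have ub : upper be'.
    move=> p z zp; rewrite mxE; have -> : (p == z) = false by rewrite -val_eqE /=; lia.
    case: andP => // -[/eqP pa /eqP zb]; move: zp; rewrite pa zb; lia.
  apply/upper_borelP; split=> //; apply/(upper_GL ub) => p; rewrite mxE eqxx.
  by case: ifP => _; [rewrite oppr_eq0 invr_eq0|case: ifP => _ //; rewrite oner_eq0].
have hu : upper_borel u.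
  have uu : upper u.
    move=> p q qp; rewrite mxE; have -> : (p == q) = false by rewrite -val_eqE /=; lia.
    case: andP => [[/eqP pa /eqP zb]|_]; last by rewrite mulr0 subr0.
    by move: qp; rewrite pa zb; lia.
  apply/upper_borelP; split=> //; apply/(upper_GL uu) => p; rewrite mxE eqxx.
  case: andP => [[/eqP pa /eqP pb]|_]; last by rewrite mulr0 subr0 oner_eq0.
  by exfalso; move: hx; rewrite -pa -pb ltnn.
have E : X m *m permutation_matrix R x *m u = be' *m permutation_matrix R (x * tperm a b).
  apply/matrixP => p q; rewrite mulmx_permutation permM.
  have -> : (X m *m permutation_matrix R x *m u) p q =
      X m p (x q) - c^-1 * (x q == b)%:R * X m p a.
    rewrite mxE (eq_bigr (fun k => X m p (x k) * (k == q)%:R -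
       X m p (x k) * (c^-1 * ((k == x^-1%g a) && (q == x^-1%g b))%:R))); last first.
      by move=> k _; rewrite mulmx_permutation [u _ _]mxE mulrBr.
    rewrite sumrB (bigD1 q) //= eqxx mulr1 [X in _ + X - _]big1 ?addr0; last first.
      by move=> k kq; rewrite (negbTE kq) mulr0.
    congr (_ - _); rewrite (bigD1 (x^-1%g a)) //= eqxx /= permKV big1 ?addr0.
      by rewrite mulrC (canF_eq (permK x)).
    by move=> k ka; rewrite (negbTE ka) /= !mulr0.
  have bnea : (b == a) = false by rewrite eq_sym.
  rewrite !mxE -/c; case: tpermP => [->|->|/eqP/negbTE xa /eqP/negbTE xb];
    rewrite ?xa ?xb ?eqxx ?aneb ?bnea ?andbT ?andbF;
    have [->|pa] := eqVneq p a; rewrite ?eqxx ?aneb ?bnea;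
    try (have [->|pb] := eqVneq p b; rewrite ?eqxx ?aneb ?bnea); rewrite ?xa ?xb ?andbF ?andbT /=;
    rewrite ?[a == x q]eq_sym ?[b == x q]eq_sym ?xa ?xb;
    try (case: (p == b)); try (case: (p == x q));
    rewrite ?mulr0 ?mul0r ?addr0 ?add0r ?subr0 ?mulr1 ?mulVf ?subrr ?sub0r ?mulr0 ?oppr0 //.
apply: ((hJ (phi m) _).1 _ f Jf).
  rewrite /phi; apply: GLM; last exact: GL_permutation.
  have : GL (X m *m permutation_matrix R x *m u).
    by rewrite E; apply: GLM; [case: hbe'|exact: GL_permutation].
  by rewrite /GL /= !unitmx_mul => /andP[/andP[-> _] _]; rewrite andbT.
rewrite -(coset_BM _ hu); apply: yF; exists (be *m be'); first exact: borelM.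
by rewrite -mulmxA -E /phi !mulmxA.
Qed.

Lemma schubert_corner (k l m r : nat) w g : (m + 1 <= n)%N -> (r <= k)%N -> (r <= l)%N ->
  (k + l <= m + r)%N -> (r <= 1)%N -> CI_permutation r k l w -> GL g ->
  (forall b x u, upper_borel b -> upper_borel u -> g = b *m permutation_matrix R x *m u ->
     (#|corner k l x| <= r)%N) ->
  flag_closure (schubert_cell w) (coset_B g).
Proof.
move=> mn rk rl klm r1 hw gg hg F [clF wF].
have [b [x [u [hb hu gE]]]] := bruhat_decomposition gg.
have [mw cw] := CI_permutation_maximal mn rk rl klm r1 hw.
pose K (y : 'S_n) := (@schubert_cell R n y `<=` F)%classic.
have xF : K x.
  apply: (@ascent_ind n k l r w K r1 _ mw cw wF) (hg _ _ _ hb hu gE); first by lia.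
  by move=> x1 y xy yF; apply: schubert_ascent xy yF.
by apply: xF; rewrite gE coset_BM //; exists b.
Qed.

End Bruhat.

(** * Rank conditions on the corner *)

Section CornerRank.
Variables (R : realType) (n k l : nat).
Local Notation C := (complex R).
Implicit Types (g h u b : 'M[C]_n) (x y w : 'S_n).

(* Expresses that the south-west l x k corner of g has rank at most r only for
   r <= 1: for every r > 0 it bounds the rank by 1. *)
Definition corner_rank (r : nat) g : Prop :=
  if r is 0%N then forall i j : 'I_n, (n - l <= i)%N -> (j < k)%N -> g i j = 0
  else forall i i' j j' : 'I_n, (n - l <= i)%N -> (n - l <= i')%N ->
    (j < k)%N -> (j' < k)%N -> g i j * g i' j' = g i j' * g i' j.

(** As b is upper triangular, the rows of the corner of b g combine only rows of the corner of g,
    and 2 x 2 minors expand bilinearly. *)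
Lemma corner_rank_left r b g : upper b -> corner_rank r g -> corner_rank r (b *m g).
Proof.
move=> hb; have tl (i i' : 'I_n) : (n - l <= i)%N -> b i i' = 0 \/ (n - l <= i')%N.
  by move=> hi; have [/hb ->|] := ltnP i' i; [left|right; lia].
case: r => [hg i j hi hj|r' hg i i' j j' hi hi' hj hj'].
  rewrite mxE big1 // => a _; have [->|ha] := tl _ a hi; first by rewrite mul0r.
  by rewrite hg ?mulr0.
rewrite !mxE !big_distrlr /=; apply: eq_bigr => a _; apply: eq_bigr => a' _.
rewrite mulrACA [RHS]mulrACA.
have [->|ha] := tl _ a hi; first by rewrite !mul0r.
have [->|ha'] := tl _ a' hi'; first by rewrite !mulr0 !mul0r.
by rewrite hg.
Qed.

Lemma corner_rank_right r g u : upper u -> corner_rank r g -> corner_rank r (g *m u).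
Proof.
move=> hu; have tl (j j' : 'I_n) : (j < k)%N -> u j' j = 0 \/ (j' < k)%N.
  by move=> hj; have [/hu ->|] := ltnP j j'; [left|right; lia].
case: r => [hg i j hi hj|r' hg i i' j j' hi hi' hj hj'].
  rewrite mxE big1 // => a _; have [->|ha] := tl _ a hj; first by rewrite mulr0.
  by rewrite hg ?mul0r.
rewrite !mxE !big_distrlr /= [RHS]exchange_big /=.
apply: eq_bigr => a _; apply: eq_bigr => a' _.
rewrite mulrACA [RHS]mulrACA [u a' j' * _]mulrC.
have [->|ha] := tl _ a hj; first by rewrite !(mul0r, mulr0).
have [->|ha'] := tl _ a' hj'; first by rewrite !(mul0r, mulr0).
by rewrite hg.
Qed.

Lemma corner_rank_permutation r x : (r <= 1)%N ->
  corner_rank r (permutation_matrix R x) <-> (#|corner k l x| <= r)%N.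
Proof.
have E i j : permutation_matrix R x i j = (x j == i)%:R by rewrite !mxE.
case: r => [|[|//]] _ /=; split.
- move=> h; rewrite leqn0 cards_eq0; apply/eqP/setP => j; rewrite !inE.
  apply/negP => /andP[jk lx]; have := h _ _ lx jk; rewrite E eqxx => /eqP.
  by rewrite oner_eq0.
- rewrite leqn0 cards_eq0 => /eqP h i j hi hj; rewrite E; case: eqP => // xj.
  by have : j \in corner k l x; [rewrite inE hj xj|rewrite h inE].
- move=> h; apply/card_le1_eqP => j j'; rewrite !inE => /andP[jk lx] /andP[jk' lx'].
  apply: contrapT => /eqP jj'; have := h _ _ _ _ lx lx' jk jk'.
  rewrite !E !eqxx [x j == x j'](inj_eq perm_inj) [j == j']eq_sym (negbTE jj') mulr0 mulr1 => /eqP.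
  by rewrite oner_eq0.
- move=> /card_le1_eqP h i i' j j' hi hi' hj hj'.
  have [->|jj'] := eqVneq j j'; first by [].
  have hh (a : 'I_n) : (n - l <= a)%N -> (x j == a) -> forall a' : 'I_n, (n - l <= a')%N ->
      (x j' == a') = false.
    move=> ha /eqP ja a' ha'; apply/negP => /eqP j'a'; case/eqP: jj'.
    by apply: h; rewrite inE ?hj ?hj' ?ja ?j'a'.
  rewrite !E; case: (boolP (x j == i)) => [h1|_].
    by rewrite !(hh _ hi h1) // mulr0 mul0r.
  rewrite mul0r; case: (boolP (x j == i')) => [h1|_]; last by rewrite mulr0.
  by rewrite (hh _ hi' h1) // mul0r.
Qed.

Lemma right_invariant_corner_rank r : right_invariant (corner_rank r).
Proof. by move=> g u /upper_borelP[_ hu]; apply: corner_rank_right. Qed.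

Lemma flag_closed_corner_rank r : flag_closed (cosets (corner_rank r)).
Proof.
have ent := @polyfun_entry R n.
case: r => [|r].
  apply: (@flag_closed_cosets _ _ _ [set f | exists ij : 'I_n * 'I_n,
     [/\ (n - l <= ij.1)%N, (ij.2 < k)%N & f = (fun g => g ij.1 ij.2)]]%classic).
  - exact: right_invariant_corner_rank.
  - by move=> f [ij [_ _ ->]]; apply: ent.
  - move=> g _; split=> [h f [ij [h1 h2 ->]]|h i j hi hj]; first exact: h.
    by apply: (h (fun g => g i j)); exists (i, j).
apply: (@flag_closed_cosets _ _ _ [set f | exists i i' j j' : 'I_n,
   [/\ (n - l <= i)%N, (n - l <= i')%N, (j < k)%N, (j' < k)%N
     & f = (fun g => g i j * g i' j' - g i j' * g i' j)]]%classic).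
- exact: right_invariant_corner_rank.
- by move=> f [i [i' [j [j' [_ _ _ _ ->]]]]]; apply: polyfunB; apply: polyfunM; apply: ent.
- move=> g _; split=> [h f [i [i' [j [j' [? ? ? ? ->]]]]]|h i i' j j' ? ? ? ?].
    by rewrite h ?subrr.
  apply/eqP; rewrite -subr_eq0; apply/eqP.
  by apply: (h (fun g => g i j * g i' j' - g i j' * g i' j)); exists i, i', j, j'.
Qed.

(** The corner condition is closed, invariant under B on both sides and true at w, hence holds on
    the closure. Conversely, invariance passes it from g to the permutation x of its Bruhat cell,
    and [ascent_ind] carries the cell of x into every closed set containing that of w. *)
Lemma flag_closure_schubert (m r : nat) w g : (m + 1 <= n)%N -> (r <= k)%N -> (r <= l)%N ->
  (k + l <= m + r)%N -> (r <= 1)%N -> CI_permutation r k l w -> GL g ->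
  flag_closure (schubert_cell w) (coset_B g) <-> corner_rank r g.
Proof.
move=> mn rk rl klm r1 hw gg; split=> [|hg].
  have [_ cw] := CI_permutation_maximal mn rk rl klm r1 hw.
  move=> /(_ (cosets (corner_rank r)))[].
    split; first exact: flag_closed_corner_rank.
    move=> _ [b hb <-]; apply/cosetsE; first exact: right_invariant_corner_rank.
      by apply: GLM; [case: hb|exact: GL_permutation].
    apply: corner_rank_left; first by case/upper_borelP: hb.
    by apply/corner_rank_permutation; rewrite ?cw.
  move=> h [gh e hh]; have [u hu ->] := coset_B_eq e.
  exact: right_invariant_corner_rank.
apply: (schubert_corner mn rk rl klm r1 hw gg) => b x u hb hu gE.
apply/(corner_rank_permutation _ r1).
have -> : permutation_matrix R x = invmx b *m (g *m invmx u).
  case: hb hu => gb _ [gu _]; rewrite gE mulmxK // mulKmx //.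
apply: corner_rank_left; first by case/upper_borelP: (borelV hb).
by apply: corner_rank_right => //; case/upper_borelP: (borelV hu).
Qed.

End CornerRank.

(** * The opposite cell *)

Section Slice.
Variables (R : realType) (n m : nat) (v : 'S_n).
Hypotheses (mn : (m + 1 <= n)%N) (hv : base_permutation m v).
Local Notation C := (complex R).
Local Notation p := (n - m - 1)%N.
Implicit Types (a g u b x : 'M[C]_n).

Let vE := base_permutationE mn hv.

Lemma base_permutationVE (i : 'I_n) :
  ((v^-1)%g i : nat) = if (p <= i)%N then (i - p)%N else (n - 1 - i)%N.
Proof.
have := vE ((v^-1)%g i); rewrite permKV; have := ltn_ord i.
have := ltn_ord ((v^-1)%g i); do 2?case: ifP; lia.
Qed.

(** The condition reads j < i when p <= j, and never holds when j < p: the off-diagonal entries form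
    a lower unitriangular block of size m + 1 in the last rows and columns. *)
Definition slice_factor a : 'M[C]_n :=
  \matrix_(i, j) if i == j then 1 else if (p + (v^-1)%g j < i)%N then a i ((v^-1)%g j) else 0.

Definition slice a : 'M[C]_n :=
  \matrix_(i, j) if i == v j then 1 else if (p + j < i)%N then a i j else 0.

Lemma sliceE a : slice a = slice_factor a *m permutation_matrix R v.
Proof. by apply/matrixP => i j; rewrite mulmx_permutation !mxE permK. Qed.

Lemma slice_factor_lower a : lower_borel (slice_factor a).
Proof.
have tr : is_trig_mx (slice_factor a).
  apply/is_trig_mxP => i j ij; rewrite mxE.
  have -> : (i == j) = false by rewrite -val_eqE /=; lia.
  have := base_permutationVE j; have := ltn_ord j; have := ltn_ord i.
  by case: ifP => h1; case: ifP => // h2; lia.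
split=> //; rewrite /GL /= unitmxE det_trig // big1 ?unitr1 // => i _.
by rewrite mxE eqxx.
Qed.

Lemma GL_slice a : GL (slice a).
Proof.
by rewrite sliceE; apply: GLM (GL_permutation _ _); case: (slice_factor_lower a).
Qed.

(** Dividing the columns j >= p of b by their diagonal entries gives those of a [slice_factor] S. So
    q = S^-1 b is diagonal in these columns and equals b in the rows before p. As v is increasing on
    its first block and decreasing on its second, conjugating q by v gives an upper triangular
    matrix, absorbed by the coset. *)
Lemma opposite_cell_slice X : opposite_cell v X <-> exists a, X = coset_B (slice a).
Proof.
split=> [[b [gb /is_trig_mxP hb] <-]|[a ->]]; last first.
  by exists (slice_factor a); [exact: slice_factor_lower|rewrite sliceE].
exists (\matrix_(i, j) (b i (v j) / b (v j) (v j))).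
set a := \matrix_(i, j) _; pose S := slice_factor a.
have [gS _] := slice_factor_lower a.
pose q := invmx S *m b.
have bq : b = S *m q by rewrite mulKVmx.
have bjj j : b j j != 0.
  have : GL b by []; rewrite /GL /= unitmxE det_trig ?unitfE => [/prodf_neq0 h|]; first exact: h.
  exact/is_trig_mxP.
have q1 (i j : 'I_n) : (p <= j)%N -> q i j = b j j * (i == j)%:R.
  move=> pj; have cb : col j b = b j j *: col j S.
    apply/colP => i'; rewrite !mxE base_permutationVE pj subnKC // permKV.
    case: (ltngtP i' j) => [ij|ji|/val_inj->].
    - have -> : (i' == j) = false by rewrite -val_eqE /=; lia.
      by rewrite hb // mulr0.
    - have -> : (i' == j) = false by rewrite -val_eqE /=; lia.
      by rewrite mulrC divfK.
    - by rewrite eqxx mulr1.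
  have : invmx S *m col j b = b j j *: (invmx S *m col j S) by rewrite cb scalemxAr.
  rewrite !colE !mulmxA mulVmx // -!colE -/q => /(congr1 (fun M : 'cV_n => M i 0)).
  by rewrite [LHS]mxE => ->; rewrite !mxE.
have q2 (i j : 'I_n) : (i < p)%N -> q i j = b i j.
  move=> ip; have -> : b i j = \sum_c S i c * q c j by rewrite {1}bq mxE.
  rewrite (bigD1 i) //= [S i i]mxE eqxx mul1r big1 ?addr0 // => c ci.
  rewrite [S i c]mxE [i == c]eq_sym (negbTE ci); case: ifP => h; last by rewrite mul0r.
  by exfalso; move: h ip; lia.
pose u := perm_mx v *m q *m permutation_matrix R v.
have uE i j : u i j = q (v i) (v j).
  by rewrite /u mulmx_permutation -row_permE mxE.
have uu : upper u.
  move=> i j ji; rewrite uE; have [pj|jp] := leqP p (v j).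
    rewrite q1 // (inj_eq perm_inj) -val_eqE /=; have -> : (i == j :> nat) = false by lia.
    by rewrite mulr0.
  have := vE i; have := vE j; have := ltn_ord i; have := ltn_ord j => hj hi vj vi.
  have jm : (j <= m)%N = false by move: vj; case: ifP => // _; lia.
  have im : (i <= m)%N = false by lia.
  rewrite jm in vj; rewrite im in vi; rewrite q2; last by lia.
  by rewrite hb //; lia.
have hu : upper_borel u.
  apply/upper_borelP; split=> //; apply: GLM (GL_permutation _ _); apply: GLM.
    by rewrite /GL /= unitmx_perm.
  by apply: GLM => //; rewrite /GL /= unitmx_inv.
rewrite -(coset_BM (slice a) hu) sliceE /u; congr coset_B.
rewrite /permutation_matrix tr_perm_mx !mulmxA -[S *m _ *m _]mulmxA -perm_mxM mulVg perm_mx1.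
by rewrite mulmx1 mulmxV // mul1mx.
Qed.

Definition clamp (E : {set 'I_n * 'I_n}) x : 'M[C]_n :=
  \matrix_(i, j) if (i, j) \in E then x i j else 0.

Lemma polymap_clamp E : polymap (clamp E).
Proof.
move=> i j; apply: (@eq_polyfun _ _ (fun x => if (i, j) \in E then x i j else 0)).
  by move=> x; rewrite mxE.
by case: ((i, j) \in E); [exact: polyfun_entry|exact: polyfun_const].
Qed.

Lemma polymap_slice psi : polymap psi -> polymap (fun x => slice (psi x)).
Proof.
move=> hpsi i j; apply: (@eq_polyfun _ _ (fun x =>
  if i == v j then 1 else if (p + j < i)%N then psi x i j else 0)).
  by move=> x; rewrite mxE.
by case: (i == v j); [|case: (p + j < i)%N]; do ?exact: polyfun_const; apply: hpsi.
Qed.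

(* These are the entries below the 1's of the identity block of v; they are the
   coordinates of the opposite cell. *)
Definition free_position : {set 'I_n * 'I_n} := [set e : 'I_n * 'I_n | (p + e.2 < e.1)%N].

(** The active coordinates lie strictly below the diagonal, so the upper triangle of the same matrix
    can carry the factor in B: the preimage in GL_n has charts with d + dim B coordinates, while a
    chain of length k gives growth dim B + k. *)
Lemma krull_dim_bound (N : set (set 'M[C]_n)) (Q : 'M[C]_n -> Prop) (J : finType)
    (act : J -> {set 'I_n * 'I_n}) (psi : J -> 'M[C]_n -> 'M[C]_n) d k Z :
  (N `<=` @flag_variety R n)%classic ->
  (forall X, N X -> exists2 a, X = coset_B (slice a) & Q a) ->
  (forall j, polymap (psi j)) ->
  (forall j e, e \in act j -> (e.2 < e.1)%N) -> (forall j, (#|act j| <= d)%N) ->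
  (forall a, Q a -> exists j x, slice a = slice (psi j (clamp (act j) x))) ->
  closed_chain (@flag_closed R n) N k Z -> (k <= d)%N.
Proof.
move=> Nfl NQ ppsi act_low act_d cover [cl st].
pose U := [set e : 'I_n * 'I_n | (e.1 <= e.2)%N].
have ZN i : (i <= k)%N -> (Z i `<=` N)%classic.
  by move=> /cl[[F _ ->] _] X [].
have grow i : (i <= k)%N -> growth (#|U| + i) (preimage_GL (Z i)).
  elim: i => [|i IHi] ik.
    have [_ [[X ZX] _]] := cl _ ik.
    have [g gg gX] := Nfl _ (ZN _ ik _ ZX).
    have [K hK] := growth_coset gg; rewrite addn0; exists K => M.
    have [T [F [cT dF iF]]] := hK M; exists T, F; split=> // la hla; apply: iF.
    move=> _ [u hu <-]; apply: hla; split; first by apply: GLM => //; case: hu.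
    by rewrite coset_BM // gX.
  have [lt nle] := st _ ik; have [[F clF ZF] _] := cl _ (ltnW ik).
  have [JF pJ hJ] := flag_closedP clF.
  have [X ZX nX] : exists2 X, Z i.+1 X & ~ Z i X.
    apply: contrapT => hno; apply: nle => X ZX; apply: contrapT => nX; apply: hno.
    by exists X.
  have NX := ZN _ ik _ ZX; have [g gg gX] := Nfl _ NX.
  have [f Jf fg] : exists2 f, JF f & f g <> 0.
    apply: contrapT => hno; apply: nX; rewrite ZF; split=> //; rewrite -gX.
    by apply/hJ => // f Jf; apply: contrapT => fg; apply: hno; exists f.
  rewrite addnS; apply: (growth_step (IHi (ltnW ik)) (f := f)).
  - by move=> g' [gg' /lt].
  - apply: prime_preimage; last by have [] := cl _ ik.
    by move=> Y /(ZN _ ik)/Nfl.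
  - exact: pJ.
  - by move=> g' [gg']; rewrite ZF => -[_ /(hJ _ gg') h]; exact: h.
  - by move=> /(_ g) h; apply: fg; apply: h; split=> //; rewrite gX.
rewrite -(leq_add2l #|U|).
apply: (growth_bound (grow k (leqnn k)) (act := fun j => act j :|: U)
  (phi := fun j x => slice (psi j (clamp (act j) x)) *m utri x)).
- move=> j; rewrite addnC; apply: leq_trans (leq_card_setU _ _) _.
  by rewrite leq_add2r.
- move=> j; apply: polymap_mulmx (@polymap_utri _ _); apply: polymap_slice.
  move=> i i'; apply: (polyfun_comp (f := fun y => psi j y i i')); first exact: ppsi.
  exact: polymap_clamp.
move=> g [gg ZX]; have [a e /cover[j [x ax]]] := NQ _ (ZN _ (leqnn k) _ ZX).
have [u hu gE] := coset_B_eq e.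
exists j, (clamp (act j) x + utri u); split.
  move=> i i'; rewrite finset.in_setU !mxE negb_or inE => /andP[/negbTE -> /negbTE /= ->].
  by rewrite addr0.
have -> : clamp (act j) (clamp (act j) x + utri u) = clamp (act j) x.
  apply/matrixP => i i'; rewrite !mxE; case: (boolP ((i, i') \in act j)) => // /act_low /= h.
  by rewrite leqNgt h /= addr0.
have -> : utri (clamp (act j) x + utri u) = u.
  apply/matrixP => i i'; rewrite !mxE; case: leqP => h; last first.
    by case/upper_borelP: hu => _ ->.
  by case: ifP => [/act_low|_] /=; rewrite ?add0r // ltnNge h.
by rewrite -ax gE.
Qed.

End Slice.

(** * Dimension of the Kazhdan-Lusztig variety *)

Lemma sum_subn_ord (m N : nat) : (m <= N)%N -> ((\sum_(j < N) (m - j)) * 2 = m * (m + 1))%N.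
Proof.
move=> mN; have -> : (\sum_(j < N) (m - j) = \sum_(j < m) (m - j))%N.
  rewrite (big_ord_widen _ (fun j => m - j)%N mN) [LHS](bigID (fun j : 'I_N => (j < m)%N)) /=.
  rewrite [X in (_ + X)%N]big1 ?addn0 // => j; rewrite -leqNgt => /eqP; exact.
elim: m {mN} => [|m IHm]; first by rewrite big_ord0.
rewrite big_ord_recl subn0 (eq_bigr (fun j : 'I_m => m - j)%N) // mulnDl IHm; lia.
Qed.

Lemma card_ord_geq (n c : nat) : #|[set j : 'I_n | (c <= j)%N]| = (n - c)%N.
Proof.
have [cn|nc] := leqP c n.
  have -> : [set j : 'I_n | (c <= j)%N] = ~: [set j : 'I_n | (j < c)%N].
    by apply/setP => j; rewrite !inE leqNgt.
  by rewrite cardsCs finset.setCK card_ord card_ord_lt.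
apply/eqP; rewrite (eqP (_ : n - c == 0)%N) ?cards_eq0; last by lia.
by apply/eqP/setP => j; rewrite !inE; have := ltn_ord j; lia.
Qed.

Lemma card_free_position (n m : nat) : (m + 1 <= n)%N ->
  (#|free_position n m| * 2 = m * (m + 1))%N.
Proof.
move=> mn; rewrite -(@sum_subn_ord m n); last by lia.
congr (_ * _)%N; rewrite -sum1_card (eq_bigl (fun e : 'I_n * 'I_n =>
  true && (n - m - 1 + e.2 < e.1)%N)); last by move=> e; rewrite inE.
rewrite -(pair_big_dep predT (fun i j : 'I_n => n - m - 1 + j < i)%N (fun _ _ => 1%N)) /=.
rewrite (exchange_big_dep predT) //=; apply: eq_bigr => j _.
rewrite sum1dep_card (_ : m - j = n - (n - m - 1 + j).+1)%N; last by lia.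
by rewrite -(card_ord_geq n (n - m - 1 + j).+1); apply: eq_card => i; rewrite !inE.
Qed.

Section KazhdanLusztig.
Variables (R : realType) (n m r k l : nat) (v w : 'S_n).
Hypotheses (mn : (m + 1 <= n)%N) (hv : base_permutation m v).
Hypotheses (rk : (r <= k)%N) (rl : (r <= l)%N) (klm : (k + l <= m + r)%N) (r1 : (r <= 1)%N).
Hypothesis hw : CI_permutation r k l w.
Local Notation C := (complex R).
Local Notation p := (n - m - 1)%N.
Local Notation KL := (@kazhdan_lusztig R n v w).
Local Notation slice := (@slice R n m v).
Local Notation free := (free_position n m).
Implicit Types (a g u b x : 'M[C]_n) (e : 'I_n -> nat).

Lemma slice_free a i j : (i, j) \in free -> slice a i j = a i j.
Proof.
rewrite inE /= => pij; rewrite mxE pij; case: eqP => // iv; exfalso.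
have := base_permutationE mn hv j; rewrite -iv; have := ltn_ord j; have := ltn_ord i.
by case: ifP; lia.
Qed.

Lemma block_free (i j : 'I_n) : (n - l <= i)%N -> (j < k)%N -> (i, j) \in free.
Proof. by rewrite inE /=; have := ltn_ord i; lia. Qed.

Lemma eq_slice a b : (forall i j, (i, j) \in free -> a i j = b i j) -> slice a = slice b.
Proof.
move=> ab; apply/matrixP => i j; rewrite !mxE; case: eqP => // _.
by case: ifP => // h; rewrite ab // inE.
Qed.

Lemma KL_flag : (KL `<=` @flag_variety R n)%classic.
Proof.
by move=> X [_ /(opposite_cell_slice mn hv)[a ->]]; exists (slice a) => //; exact: GL_slice.
Qed.

Lemma KL_slice a : KL (coset_B (slice a)) <-> corner_rank k l r (slice a).
Proof.
have gs := GL_slice mn hv a.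
rewrite -(flag_closure_schubert mn rk rl klm r1 hw gs); split=> [[]|] //.
by move=> h; split=> //; apply/(opposite_cell_slice mn hv); exists a.
Qed.

Lemma KLP X : KL X -> exists2 a, X = coset_B (slice a) & corner_rank k l r (slice a).
Proof.
move=> h; have [_ /(opposite_cell_slice mn hv)[a e]] := h; exists a => //.
by apply/KL_slice; rewrite -e.
Qed.

(** Two closed sets neither of which contains [Z] have equations that are not identically zero on
    the image of [psi], while their product is zero there; this contradicts primality. *)
Lemma irreducible_image (psi : 'M[C]_n -> 'M[C]_n) Z : polymap psi ->
  (forall x, Z (coset_B (slice (psi x)))) ->
  (forall X, Z X -> exists x, X = coset_B (slice (psi x))) ->
  irreducible (@flag_closed R n) Z.
Proof.
move=> ppsi Zpsi psiZ; split; first by exists (coset_B (slice (psi 0))).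
move=> F1 F2 /flag_closedP[J1 p1 h1] /flag_closedP[J2 p2 h2] Z12.
apply: contrapT => hno.
have sep F J : (forall g, GL g -> F (coset_B g) <-> zeros J g) -> ~ (Z `<=` F)%classic ->
    exists2 f, J f & exists x, f (slice (psi x)) <> 0.
  move=> hF nF; apply: contrapT => h; apply: nF => X /psiZ[x ->].
  apply/hF; first exact: (GL_slice mn hv).
  move=> f Jf; apply: contrapT => nf; apply: h; exists f => //; by exists x.
have [f1 J1f [x1 hx1]] := sep _ _ h1 (fun h => hno (or_introl h)).
have [f2 J2f [x2 hx2]] := sep _ _ h2 (fun h => hno (or_intror h)).
have pW : prime_set [set g | exists x, g = slice (psi x)]%classic.
  apply: (@prime_image _ _ (fun x => slice (psi x)) (fun=> 1) 0).
  - exact: polymap_slice.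
  - exact: polyfun_const.
  - exact: oner_neq0.
  - by move=> x _; exists x.
  - by move=> g [x ->]; exists x => //; exact: oner_neq0.
have [|h|h] := pW _ _ (p1 _ J1f) (p2 _ J2f).
- move=> g [x ->]; have gs := GL_slice mn hv (psi x).
  case: (Z12 _ (Zpsi x)) => [/(h1 _ gs) hz|/(h2 _ gs) hz].
    by rewrite hz // mul0r.
  by rewrite [X in _ * X]hz // mulr0.
- by apply: hx1; apply: h; exists x1.
- by apply: hx2; apply: h; exists x2.
Qed.

(** Prefixes of rows are used because right multiplication by B adds columns only to later ones, so
    that this condition descends to cosets. *)
Definition prefix_zero e g := forall i j : 'I_n, (j < e i)%N -> (i, j) \in free -> g i j = 0.

Lemma right_invariant_prefix_zero e : right_invariant (prefix_zero e).
Proof.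
move=> g u /upper_borelP[_ hu] hg i j je hf; rewrite mxE big1 // => c _.
have [jc|cj] := ltnP j c; first by rewrite hu ?mulr0.
rewrite hg ?mul0r //; first exact: leq_ltn_trans cj je.
by move: hf; rewrite !inE /=; lia.
Qed.

Lemma flag_closed_prefix_zero e : flag_closed (cosets (prefix_zero e)).
Proof.
apply: (@flag_closed_cosets _ _ _ [set f | exists ij : 'I_n * 'I_n,
   [/\ (ij.2 < e ij.1)%N, ij \in free & f = (fun g => g ij.1 ij.2)]]%classic).
- exact: right_invariant_prefix_zero.
- by move=> f [ij [_ _ ->]]; apply: polyfun_entry.
- move=> g _; split=> [h f [[i j] [h1 h2 ->]]|h i j hj hf]; first exact: h.
  by apply: (h (fun g => g i j)); exists (i, j).
Qed.

Definition KL_prefix e : set (set 'M[C]_n) := (KL `&` cosets (prefix_zero e))%classic.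

Lemma KL_prefix_slice e a : KL_prefix e (coset_B (slice a)) <->
  corner_rank k l r (slice a) /\ prefix_zero e a.
Proof.
have gs := GL_slice mn hv a.
have E : prefix_zero e (slice a) <-> prefix_zero e a.
  by split=> h i j hj hf; have := h i j hj hf; rewrite slice_free.
rewrite -KL_slice -E; split=> [[h1 /cosetsE h2]|[h1 h2]].
  by split=> //; apply: h2 => //; exact: right_invariant_prefix_zero.
by split=> //; apply/cosetsE => //; exact: right_invariant_prefix_zero.
Qed.

Lemma KL_prefixP e X : KL_prefix e X -> exists2 a, X = coset_B (slice a) &
  corner_rank k l r (slice a) /\ prefix_zero e a.
Proof.
move=> h; have [/KLP[a eX _] _] := h; exists a => //.
by apply/KL_prefix_slice; rewrite -eX.
Qed.

Definition chain_to (q : nat) Z := exists2 Zs, closed_chain (@flag_closed R n) KL q Zs & Zs q = Z.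

Lemma chain_to0 Z : closed_in (@flag_closed R n) KL Z -> irreducible (@flag_closed R n) Z ->
  chain_to 0 Z.
Proof. by move=> cZ iZ; exists (fun=> Z). Qed.

Lemma chain_toS q Z Z' : chain_to q Z -> closed_in (@flag_closed R n) KL Z' ->
  irreducible (@flag_closed R n) Z' -> (Z `<` Z')%classic -> chain_to q.+1 Z'.
Proof.
move=> [Zs [h1 h2] e] cZ iZ lt; exists (fun i => if (i <= q)%N then Zs i else Z'); last by rewrite ltnn.
split=> i iq; first by case: ifP => // h; apply: h1.
rewrite -ltnS iq; case: ifP => h; first exact: (h2 i h).
have iq' : i = q by lia.
by rewrite iq' e.
Qed.

Lemma closed_KL_prefix e : closed_in (@flag_closed R n) KL (KL_prefix e).
Proof. by exists (cosets (prefix_zero e)) => //; exact: flag_closed_prefix_zero. Qed.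

(** Within the block at most the last column survives, and nothing if r = 0. The rank condition is
    then automatic, so [KL_prefix e] is an affine space. *)
Definition admissible e := forall i j : 'I_n, (n - l <= i)%N -> (j < k)%N -> (e i <= j)%N ->
  r = 1%N /\ (j : nat) = k.-1.

Definition cut e x : 'M[C]_n := \matrix_(i, j) if (e i <= j)%N then x i j else 0.

Lemma KL_prefix_cut e x : admissible e -> KL_prefix e (coset_B (slice (cut e x))).
Proof.
move=> ae; apply/KL_prefix_slice; split; last first.
  by move=> i j je _; rewrite mxE leqNgt je.
have z (i j : 'I_n) : (n - l <= i)%N -> (j < k)%N -> r <> 1%N \/ (j : nat) <> k.-1 ->
    slice (cut e x) i j = 0.
  move=> hi hj hr; rewrite slice_free ?block_free // mxE; case: ifP => // h.
  by have [] := ae _ _ hi hj h; case: hr.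
case: r r1 z => [|[|//]] _ z /=; first by move=> i j hi hj; apply: z => //; left.
move=> i i' j j' hi hi' hj hj'; have [->|jj'] := eqVneq j j'; first by [].
have [jk|jk] := eqVneq (j : nat) k.-1.
  by rewrite (z i' j') ?(z i j') ?mulr0 ?mul0r //; right => e'; case/eqP: jj'; apply: val_inj;
    rewrite /= jk e'.
by rewrite (z i j) ?(z i' j) ?mulr0 ?mul0r //; right; apply/eqP.
Qed.

Lemma irreducible_KL_prefix e : admissible e -> irreducible (@flag_closed R n) (KL_prefix e).
Proof.
move=> ae; apply: (@irreducible_image (cut e)).
- move=> i j; apply: (@eq_polyfun _ _ (fun x => if (e i <= j)%N then x i j else 0)).
    by move=> x; rewrite mxE.
  by case: (e i <= j)%N; [exact: polyfun_entry|exact: polyfun_const].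
- by move=> x; apply: KL_prefix_cut.
- move=> X /KL_prefixP[a -> [_ pa]]; exists a; congr coset_B; apply: eq_slice => i j hf.
  by rewrite mxE; case: leqP => // je; rewrite pa.
Qed.

(** Induction on the number of surviving coordinates: killing the leftmost one of some row is again
    a prefix condition and removes exactly one coordinate. *)
Lemma chain_to_admissible e : admissible e ->
  chain_to #|[set ij in free | (e ij.1 <= ij.2)%N]| (KL_prefix e).
Proof.
have [N] := ubnP #|[set ij in free | (e ij.1 <= ij.2)%N]|; elim: N e => // N IHN e.
set Phi := [set ij in free | _] => hN ae.
have [->|[[i j0] ij0]] := set_0Vmem Phi.
  by rewrite cards0; apply: chain_to0; [exact: closed_KL_prefix|exact: irreducible_KL_prefix].
have [j ijPhi jmin] : exists2 j : 'I_n, (i, j) \in Phi &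
    forall j' : 'I_n, (i, j') \in Phi -> (j <= j')%N.
  by case: (@arg_minnP _ j0 (fun j => (i, j) \in Phi) (fun j : 'I_n => (j : nat)) ij0) => j h1 h2; exists j.
have [hf eij] : (i, j) \in free /\ (e i <= j)%N by move: ijPhi; rewrite inE => /andP[].
pose e' i' := if i' == i then j.+1 else e i'.
have ee' i' : (e i' <= e' i')%N by rewrite /e'; case: eqP => [->|]; lia.
have PhiE : [set ij in free | (e' ij.1 <= ij.2)%N] = Phi :\ (i, j).
  apply/setP => -[a b]; rewrite !inE xpair_eqE /= /e'; case: (eqVneq a i) => [->|ai] //=.
  have := jmin b; rewrite !inE /= -(inj_eq val_inj) /=.
  by case: (ltngtP b j) => //; case: (leqP (e i) b); rewrite ?andbF ?andbT //; lia.
have ae' : admissible e'.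
  by move=> i' j' h1 h2 h3; apply: ae h1 h2 _; apply: leq_trans (ee' _) h3.
have cPhi : #|Phi| = #|Phi :\ (i, j)|.+1 by rewrite (cardsD1 (i, j)) ijPhi.
rewrite cPhi -PhiE; apply: (@chain_toS _ (KL_prefix e')).
- by apply: IHN => //; rewrite PhiE; move: hN; rewrite cPhi.
- exact: closed_KL_prefix.
- exact: irreducible_KL_prefix.
split.
  move=> X /KL_prefixP[a -> [ra pa]]; apply/KL_prefix_slice; split=> // i' j' h; apply: pa.
  exact: leq_trans h (ee' _).
(* The matrix unit at (i, j) separates the two sets. *)
move=> /(_ _ (KL_prefix_cut (delta_mx i j) ae))/KL_prefix_slice[_].
move=> /(_ i j); rewrite /e' eqxx ltnS leqnn => /(_ isT hf).
by rewrite !mxE eij !eqxx => /eqP; rewrite oner_eq0.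
Qed.


Lemma card_rectangle (a c : nat) : (a <= l)%N -> (c <= k)%N ->
  #|[set ij in free | ~~ ((n - a <= ij.1)%N && (ij.2 < c)%N)]| = (#|free| - a * c)%N.
Proof.
move=> al ck; pose B := finset.setX [set i : 'I_n | (n - a <= i)%N] [set j : 'I_n | (j < c)%N].
have -> : [set ij in free | ~~ ((n - a <= ij.1)%N && (ij.2 < c)%N)] = free :\: B.
  by apply/setP => -[i j]; rewrite !inE /= andbC.
rewrite cardsD (finset.setIidPr _); last first.
  apply/fintype.subsetP => -[i j]; rewrite !inE /= => /andP[h1 h2].
  by have := @block_free i j; rewrite inE /=; apply; lia.
by rewrite cardsX card_ord_geq card_ord_lt; [congr (_ - _ * _)%N; lia|lia].
Qed.

Lemma card_block : (l * k <= #|free|)%N.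
Proof.
have <- : #|finset.setX [set i : 'I_n | (n - l <= i)%N] [set j : 'I_n | (j < k)%N]| = (l * k)%N.
  by rewrite cardsX card_ord_geq card_ord_lt; [congr (_ * _)%N; lia|lia].
apply/subset_leq_card/fintype.subsetP => -[i j]; rewrite finset.in_setX !inE /= => /andP[h1 h2].
by have := block_free h1 h2; rewrite inE.
Qed.

Definition block_cut (c : nat) (i : 'I_n) : nat := if (n - l <= i)%N then c else 0%N.

Lemma block_cut_admissible : admissible (block_cut (k - r)).
Proof.
move=> i j hi hj; rewrite /block_cut hi => h.
by case: (posnP r) => [r0|r0]; move: h; [rewrite r0; lia|split; lia].
Qed.

Lemma chain_to_block_cut : chain_to (#|free| - l * (k - r)) (KL_prefix (block_cut (k - r))).
Proof.
have := chain_to_admissible block_cut_admissible.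
rewrite -(@card_rectangle l (k - r)) ?leq_subr //.
suff -> : [set ij in free | (block_cut (k - r) ij.1 <= ij.2)%N] =
  [set ij in free | ~~ ((n - l <= ij.1)%N && (ij.2 < k - r)%N)] by [].
apply/setP => -[i j]; rewrite !inE /block_cut /=; congr (_ && _).
by case: ifP => _ //; rewrite -leqNgt.
Qed.

Lemma rank_one_pivot a : r = 1%N -> corner_rank k l r (slice a) ->
  exists (i0 : 'I_n) (s : 'I_n -> C), [/\ (n - l <= i0)%N, s i0 = 1 &
    forall i j : 'I_n, (n - l <= i)%N -> (j < k)%N -> a i j = s i * a i0 j].
Proof.
move=> re; rewrite re => ca.
have minor (i i' j j' : 'I_n) : (n - l <= i)%N -> (n - l <= i')%N -> (j < k)%N -> (j' < k)%N ->
    a i j * a i' j' = a i j' * a i' j.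
  by move=> h1 h2 h3 h4; have := ca i i' j j' h1 h2 h3 h4; rewrite !slice_free ?block_free.
have [[i0 [j0 [hi hj a0]]]|hno] := pselect (exists i j : 'I_n,
    [/\ (n - l <= i)%N, (j < k)%N & a i j != 0]).
  exists i0, (fun i => a i j0 / a i0 j0); split=> //; first by rewrite divff.
  by move=> i j h1 h2; rewrite mulrAC (minor i i0 j0 j) // mulfK.
have a0 (i j : 'I_n) : (n - l <= i)%N -> (j < k)%N -> a i j = 0.
  by move=> h1 h2; apply: contrapT => /eqP h; apply: hno; exists i, j.
(* For a zero block any of its rows serves as pivot; the last row belongs to the block because l >=
   r = 1. *)
have hn : (n.-1 < n)%N by lia.
exists (Ordinal hn), (fun=> 1); split=> //=; first by lia.
by move=> i j h1 h2; rewrite !a0 ?mulr0 //=; lia.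
Qed.

(** The diagonal entries, which [slice] never reads, store both vectors of the product; the row
    indices i >= n - l and the column indices j < k are disjoint. *)
Definition rank_one (c : nat) x : 'M[C]_n := \matrix_(i, j)
  if (n - l <= i)%N && (j < k)%N then (if (c <= j)%N then x i i * x j j else 0) else x i j.

Lemma polymap_rank_one c : polymap (rank_one c).
Proof.
move=> i j; apply: (@eq_polyfun _ _ (fun x => if (n - l <= i)%N && (j < k)%N
    then (if (c <= j)%N then x i i * x j j else 0) else x i j)).
  by move=> x; rewrite mxE.
have ent := @polyfun_entry R n.
case: (_ && _); last exact: ent.
by case: (c <= j)%N; [apply: polyfunM; apply: ent|exact: polyfun_const].
Qed.

Lemma KL_prefix_rank_one c x : r = 1%N -> (c <= k)%N ->
  KL_prefix (block_cut c) (coset_B (slice (rank_one c x))).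
Proof.
move=> re ck; apply/KL_prefix_slice; split; last first.
  move=> i j; rewrite /block_cut; case: ifP => // hi jc hf; rewrite mxE hi /= [(c <= j)%N]leqNgt jc.
  by rewrite (leq_trans jc ck).
rewrite re => i i' j j' h1 h2 h3 h4; rewrite !slice_free ?block_free // !mxE h1 h2 h3 h4 /=.
by do 2?case: ifP => _; rewrite ?mulr0 ?mul0r // mulrACA [RHS]mulrACA [x j' j' * _]mulrC.
Qed.

Lemma irreducible_rank_one c : r = 1%N -> (c <= k)%N ->
  irreducible (@flag_closed R n) (KL_prefix (block_cut c)).
Proof.
move=> re ck; apply: (@irreducible_image (rank_one c)).
- exact: polymap_rank_one.
- by move=> x; apply: KL_prefix_rank_one.
- move=> X /KL_prefixP[a -> [ca pa]]; have [i0 [s [hi0 _ hs]]] := rank_one_pivot re ca.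
  exists (\matrix_(i, j) if i == j then (if (n - l <= i)%N then s i else a i0 i) else a i j).
  congr coset_B; apply: eq_slice => i j hf; rewrite !mxE !eqxx.
  case: ifP => [/andP[hi hj]|_].
    rewrite hi; have -> : (n - l <= j)%N = false by lia.
    case: leqP => jc; first exact: hs.
    by rewrite pa // /block_cut hi.
  by move: hf; rewrite inE /= => hf; have -> : (i == j) = false by rewrite -val_eqE /=; lia.
Qed.

(** Starting from the sets where only the last column of the block may be nonzero, each step opens
    one more column to its left within the matrices of rank at most one. *)
Lemma chain_to_rank_one q : r = 1%N -> (q < k)%N ->
  chain_to (#|free| - l * (k - r) + q) (KL_prefix (block_cut (k - r - q))).
Proof.
move=> re; elim: q => [|q IHq] qk; first by rewrite addn0 subn0; exact: chain_to_block_cut.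
rewrite addnS; apply: (chain_toS (IHq (ltnW qk))).
- exact: closed_KL_prefix.
- by apply: irreducible_rank_one => //; lia.
split.
  move=> X /KL_prefixP[a -> [ca pa]]; apply/KL_prefix_slice; split=> // i j h; apply: pa.
  by apply: leq_trans h _; rewrite /block_cut; case: ifP => _ //; lia.
have hk : (k - r - q.+1 <= k)%N by lia.
(* The block equal to 1 from the newly opened column on separates the two sets. *)
move=> /(_ _ (KL_prefix_rank_one (const_mx 1) re hk))/KL_prefix_slice[_].
have hn : (n.-1 < n)%N by lia.
have hj : (k - r - q.+1 < n)%N by lia.
move=> /(_ (Ordinal hn) (Ordinal hj)); rewrite /block_cut !mxE /=.
have -> : (n - l <= n.-1)%N by lia.
have -> : (k - r - q.+1 < k)%N by lia.
rewrite leqnn mulr1 => h; suff /eqP : 1 = 0 :> C by rewrite oner_eq0.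
by apply: h; [lia|apply: block_free => /=; lia].
Qed.

Lemma KL_chain : exists Z, closed_chain (@flag_closed R n) KL (#|free| - (l - r) * (k - r)) Z.
Proof.
case: (posnP r) => [r0|r0].
  by have [Z h _] := chain_to_block_cut; exists Z; rewrite r0 subn0 in h *; rewrite subn0.
have re : r = 1%N by lia.
have [|Z h _] := @chain_to_rank_one k.-1 re; first by lia.
exists Z; suff -> : (#|free| - (l - r) * (k - r) = #|free| - l * (k - r) + k.-1)%N by [].
have le := @card_rectangle l (k - r) (leqnn _) (leq_subr _ _).
have : (l * (k - r) <= #|free|)%N by apply: leq_trans card_block; rewrite leq_mul2l leq_subr orbT.
have : (l * (k - r) = (l - r) * (k - r) + (k - r))%N.
  by rewrite -[X in (_ + X)%N]mul1n -mulnDl; congr (_ * _)%N; lia.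
rewrite re; lia.
Qed.

(** Each row of the block is a multiple of row [i0]; the multiplier of row i is stored at (i, j0),
    and that of row [i0] is 1. *)
Definition pivot_chart (i0 j0 : 'I_n) x : 'M[C]_n := \matrix_(i, j)
  if (n - l <= i)%N && (j < k)%N then (if i == i0 then 1 else x i j0) * x i0 j else x i j.

(** For r = 0 one chart suffices, on the coordinates outside the block. For r = 1 there is one chart
    per pivot row, adding l - 1 multipliers and the k entries of that row, and l k - (l - 1) - k =
    (l - 1) (k - 1). Rows outside the block get an empty set of coordinates. *)
Lemma KL_chain_bound q Z : closed_chain (@flag_closed R n) KL q Z ->
  (q <= #|free| - (l - r) * (k - r))%N.
Proof.
move=> hZ; have freelow (ij : 'I_n * 'I_n) : ij \in free -> (ij.2 < ij.1)%N.
  by rewrite inE; lia.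
have outer := @card_rectangle l k (leqnn _) (leqnn _).
case: (posnP r) => [r0|r0].
  rewrite r0 !subn0 -outer.
  move: hZ; apply: (@krull_dim_bound R n m v KL (fun a => corner_rank k l r (slice a)) unit
    (fun=> [set ij in free | ~~ ((n - l <= ij.1)%N && (ij.2 < k)%N)]) (fun _ x => x)) => //.
  - exact: KL_flag.
  - exact: KLP.
  - by move=> _; apply: polymap_id.
  - by move=> _ ij; rewrite inE => /andP[/freelow].
  - rewrite r0 => a ca; exists tt, a; apply: eq_slice => i j hf; rewrite mxE inE hf /=.
    case: ifP => // /negbT; rewrite negbK => /andP[hi hj].
    by have := ca i j hi hj; rewrite slice_free ?block_free.
have re : r = 1%N by lia.
have hj0 : (k.-1 < n)%N by lia.
pose j0 := Ordinal hj0.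
pose out := [set ij in free | ~~ ((n - l <= ij.1)%N && (ij.2 < k)%N)].
pose low := [set i : 'I_n | (n - l <= i)%N].
pose cross (i0 : 'I_n) := [set (i, j0) | i in low :\ i0] :|: [set (i0, j) | j in [set j : 'I_n | (j < k)%N]].
pose act (i0 : 'I_n) := if (n - l <= i0)%N then out :|: cross i0 else finset.set0.
have cross_free (i0 : 'I_n) ij : (n - l <= i0)%N -> ij \in cross i0 -> ij \in free.
  move=> hi0; rewrite finset.in_setU => /orP[/imsetP[i + ->]|/imsetP[j + ->]].
    by rewrite !inE => /andP[_ hi]; have := @block_free i j0 hi; rewrite inE; apply; rewrite /=; lia.
  by rewrite !inE => hj; have := block_free hi0 hj; rewrite inE.
move: hZ; apply: (@krull_dim_bound R n m v KL (fun a => corner_rank k l r (slice a)) 'I_n act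
  (fun i0 => pivot_chart i0 j0)) => //.
- exact: KL_flag.
- exact: KLP.
- move=> i0 i j; apply: (@eq_polyfun _ _ (fun x => if (n - l <= i)%N && (j < k)%N
    then (if i == i0 then 1 else x i j0) * x i0 j else x i j)).
    by move=> x; rewrite mxE.
  have ent := @polyfun_entry R n.
  case: (_ && _); last exact: ent.
  by apply: polyfunM; [case: (i == i0); [exact: polyfun_const|exact: ent]|exact: ent].
- move=> i0 ij; rewrite /act; case: ifP => hi0; last by rewrite inE.
  rewrite finset.in_setU => /orP[|/(cross_free _ _ hi0)/freelow //].
  by rewrite inE => /andP[/freelow].
- move=> i0; rewrite /act; case: ifP => hi0; last by rewrite cards0.
  apply: leq_trans (leq_card_setU _ _) _; rewrite outer.
  have : (#|cross i0| <= l.-1 + k)%N.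
    apply: leq_trans (leq_card_setU _ _) _; apply: leq_add.
      apply: leq_trans (leq_imset_card _ _) _.
      have c0 : #|low| = l by rewrite card_ord_geq; lia.
      have c1 : i0 \in low by rewrite inE.
      by have := cardsD1 i0 low; rewrite c0 c1 => ->.
    by apply: leq_trans (leq_imset_card _ _) _; rewrite card_ord_lt; lia.
  have := card_block.
  have : (l * k + 1 = (l - r) * (k - r) + l + k)%N.
    have l1 : (0 < l)%N by lia.
    have k1 : (0 < k)%N by lia.
    by rewrite re -(prednK l1) -(prednK k1) !subSS !subn0 mulSn mulnS; lia.
  move: (l * k)%N ((l - r) * (k - r))%N #|free| #|cross i0| => x y f c; lia.
- move=> a ca; have [i0 [s [hi0 s0 hs]]] := rank_one_pivot re ca.
  exists i0, (\matrix_(i, j) if (n - l <= i)%N && (i != i0) && (j == j0) then s i else a i j).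
  apply: eq_slice => i j hf.
  have actE ij : (ij \in act i0) = (ij \in out) || (ij \in cross i0).
    by rewrite /act hi0 finset.in_setU.
  have rowE (j' : 'I_n) : (j' < k)%N -> (i0, j') \in act i0.
    move=> hj; rewrite actE finset.in_setU; apply/orP; right; apply/orP; right.
    by apply/imsetP; exists j'; rewrite ?inE.
  have colE (i' : 'I_n) : (n - l <= i')%N -> i' != i0 -> (i', j0) \in act i0.
    move=> hi ii; rewrite actE finset.in_setU; apply/orP; right; apply/orP; left.
    by apply/imsetP; exists i'; rewrite ?inE ?ii.
  rewrite mxE; case: ifP => [/andP[hi hj]|hij].
    rewrite (hs _ _ hi hj) [clamp _ _ i0 j]mxE rowE // mxE eqxx andbF /=.
    have [->|ii] := eqVneq i i0; first by rewrite s0.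
    by rewrite mxE colE // mxE hi ii eqxx.
  rewrite mxE actE inE hf hij /= mxE.
  by have -> : (n - l <= i)%N && (i != i0) && (j == j0) = false; [|];
    first by (apply/negbTE/negP => /andP[/andP[hi _] /eqP e]; move: hij; rewrite hi e /=; lia).
Qed.

Lemma krull_dim_KL :
  krull_dim R (@flag_closed R n) KL = (#|free| - (l - r) * (k - r))%N%:R%:E.
Proof.
apply/le_anti/andP; split.
  by apply: ge_ereal_sup => _ [q [Z hZ] <-]; rewrite lee_fin ler_nat (KL_chain_bound hZ).
by apply: ereal_sup_ubound; exists (#|free| - (l - r) * (k - r))%N => //; exact: KL_chain.
Qed.

End KazhdanLusztig.

(** * The weight cone *)

Section WeightCone.
Variables (R : realType) (n m r k l : nat) (v w : 'S_n).
Hypotheses (mn : (m + 1 <= n)%N) (hv : base_permutation m v).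
Hypotheses (rk : (r <= k)%N) (rl : (r <= l)%N) (klm : (k + l <= m + r)%N) (r1 : (r <= 1)%N).
Hypothesis hw : CI_permutation r k l w.
Local Notation p := (n - m - 1)%N.

(** The diagram consists of non-inversions, and a value below p, being in the decreasing tail,
    stands to the right of every larger value. *)
Lemma opposite_diagram_block (e : 'I_n * 'I_n) :
  opposite_diagram v e -> (p <= v e.2)%N /\ (p <= e.1)%N.
Proof.
case: e => i j; rewrite /opposite_diagram /= => /andP[vi jv].
have := base_permutationE mn hv j; have := base_permutationVE mn hv i.
have := ltn_ord i; have := ltn_ord j; do 2?case: ifP; lia.
Qed.

Lemma weight_index_simple (q q' : 'I_n) : (p <= q)%N -> (q' : nat) = q.+1 ->
  weight_index v w (q', (v^-1)%g q).
Proof.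
move=> pq qq'; rewrite /weight_index /opposite_diagram /= permKV; apply/andP; split.
  by rewrite !(base_permutationVE mn hv) qq' pq (leqW pq); lia.
exact: (bruhat_le_corner mn rk rl klm r1 hw (base_corner mn klm hv r1 qq' pq)).
Qed.

(** The vectors e_a - e_{n-1} with p <= a < n - 1 form a basis of the span. Every weight is a
    difference of two of them (or of 0), and each telescopes into the weights e_a - e_{a+1} of
    [weight_index_simple]. *)
Lemma cone_dim_KL : cone_dim (@weight_cone R n v w) = m.
Proof.
have n0 : (n.-1 < n)%N by lia.
have qP (i : 'I_m) : (p + i < n)%N by have := ltn_ord i; lia.
pose z := Ordinal n0; pose q i := Ordinal (qP i).
pose d (a : 'I_n) : 'rV[R]_n := delta_mx 0 a - delta_mx 0 z.
pose X := [tuple d (q i) | i < m].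
have Xi (i : 'I_m) : X`_i = d (q i) by rewrite -tnth_nth tnth_mktuple.
have freeX : free X.
  apply/freeP => c hc i; have := congr1 (fun x : 'rV[R]_n => x 0 (q i)) hc.
  rewrite summxE (bigD1 i) //= big1 => [|j ji]; rewrite Xi !mxE -!val_eqE /=.
    rewrite eqxx addr0; have -> : (p + i == n.-1)%N = false by have := ltn_ord i; lia.
    by rewrite subr0 mulr1.
  have -> : (p + i == n.-1)%N = false by have := ltn_ord i; lia.
  have -> : (p + i == p + j)%N = false by move: ji; rewrite -val_eqE /=; lia.
  by rewrite subr0 mulr0.
have dX (a : 'I_n) : (p <= a)%N -> d a \in <<X>>%VS.
  move=> pa; have [az|az] := eqVneq a z; first by rewrite /d az subrr mem0v.
  have ha : (a - p < m)%N by have := ltn_ord a; move: az; rewrite -val_eqE /=; lia.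
  apply: memv_span; apply/tnthP; exists (Ordinal ha); rewrite tnth_mktuple.
  by congr d; apply: val_inj => /=; lia.
have KX x : weight_cone v w x -> x \in <<X>>%VS.
  move=> [c _ ->]; apply: memv_suml => e /andP[/opposite_diagram_block[h1 h2] _].
  apply: memvZ; rewrite /weight.
  have -> : delta_mx 0 (v e.2) - delta_mx 0 e.1 = d (v e.2) - d e.1 :> 'rV[R]_n.
    by rewrite /d opprB addrA subrK.
  by apply: memvB; apply: dX.
have XW (W : {vspace 'rV[R]_n}) : (forall x, weight_cone v w x -> x \in W) -> (<<X>> <= W)%VS.
  move=> hW; apply/span_subvP => _ /tnthP[i ->]; rewrite tnth_mktuple.
  have dW (N : nat) (a : 'I_n) : (p <= a)%N -> (n - a <= N.+1)%N -> d a \in W.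
    elim: N a => [|N IHN] a pa aN.
      have az : a = z by apply: val_inj => /=; have := ltn_ord a; lia.
      by rewrite /d az subrr mem0v.
    have [az|az] := eqVneq a z; first by rewrite /d az subrr mem0v.
    have ha : (a.+1 < n)%N by have := ltn_ord a; move: az; rewrite -val_eqE /=; lia.
    pose a' := Ordinal ha.
    have -> : d a = weight R v (a', (v^-1)%g a) + d a'.
      by rewrite /d /weight /= permKV addrA subrK.
    apply: memvD; last by apply: IHN; rewrite /=; lia.
    apply: hW; exists (fun e => (e == (a', (v^-1)%g a))%:R) => [e|]; first exact: ler0n.
    have wi := @weight_index_simple a a' pa erefl.
    rewrite (bigD1 (a', (v^-1)%g a)) //= eqxx scale1r big1 ?addr0 // => e /andP[_ /negbTE ->].
    by rewrite scale0r.
  by apply: (dW n); rewrite /=; lia.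
(* [linear_span] is a choice with default 0; the span of [X] shows that a smallest subspace exists,
   and two smallest subspaces contain each other. *)
rewrite /cone_dim /linear_span; set P := (X in xget _ X).
have [h1 h2] : P (xget 0%VS P) by apply: xgetPex; exists <<X>>%VS; split.
have -> : xget 0%VS P = <<X>>%VS.
  by apply/eqP; rewrite eqEsubv (h2 _ KX) (XW _ h1).
by move: freeX; rewrite /free => /eqP ->; rewrite size_tuple.
Qed.

Lemma complexity_KL : complexity R v w =
  (m%:R * ((m%:R - 1) / 2%:R) - ((k - r) * (l - r))%N%:R)%:E.
Proof.
rewrite /complexity (krull_dim_KL R mn hv rk rl klm r1 hw) cone_dim_KL -EFinB.
congr EFin; have cf := card_free_position mn.
rewrite natrB; last first.
  by apply: leq_trans (card_block mn rk rl klm r1); rewrite leq_mul ?leq_subr.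
have : (#|free_position n m|%:R * 2 = m%:R * (m%:R + 1) :> R).
  by rewrite -natrM cf natrM natrD.
rewrite [((k - r) * _)%N]mulnC; move: (#|free_position n m|%:R) (((l - r) * (k - r))%N%:R) => f b hf.
have -> : f = m%:R * (m%:R + 1) / 2 by rewrite -hf mulfK.
by field.
Qed.

End WeightCone.

Theorem proposition5p13 (R : realType) (n m : nat) (hnm : (m + 1 <= n)%N)
    (v w : 'S_n) (A B C : {set 'I_m})
    (hv : base_permutation m v)
    (hw : marginal_CI_case w A B C \/ conditional_CI_case w A B C) :
  complexity R v w =
    (m%:R * ((m%:R - 1) / 2%:R) - #|A|%:R * #|B|%:R)%:E.
Proof.
rewrite -natrM; case: hw.
- move=> /(marginal_CI_caseP hnm)[k [l [klm hw ->]]].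
  by rewrite (complexity_KL R hnm hv _ _ _ _ hw) ?subn0 // addn0.
- move=> /(conditional_CI_caseP hnm)[k [l [k0 l0 klm hw ->]]].
  by rewrite (complexity_KL R hnm hv _ _ _ _ hw) // !subn1.
Qed.
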